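(* Let $\nu>0$ be a constant, $\eta>0$, and let $A,B_1,B_2,M_{Q_h}$ be the matrices of the discrete mass-conserving mixed stress (MCS) Stokes system defined in the context. Let $$\bar{\mathcal A}_\eta=\begin{bmatrix}A&B_2^T&0\\-B_2&\eta\nu B_1^TM_{Q_h}^{-1}B_1&-B_1^T\\0&B_1&0\end{bmatrix},\qquad \hat{\mathcal L}_{\eta,T}=\begin{bmatrix}H_{\Sigma_h^+}&0&0\\-B_2&H_{U_h}&0\\0&B_1&H_{Q_h}\end{bmatrix}^{-1},$$ where $H_{\Sigma_h^+},H_{U_h},H_{Q_h}$ are SPD matrices (on $\Sigma_h^+$, $U_h$, $Q_h$ respectively), and let $S_{U_h,\eta}=B_2A^{-1}B_2^T+\eta\nu B_1^TM_{Q_h}^{-1}B_1$ and $S_{Q_h,\eta}=B_1S_{U_h,\eta}^{-1}B_1^T$. Assume that there exist constants $\rho_{\Sigma_h^+},\rho_{U_h}\in[0,1)$, independent of $\nu$ and $h$, such that $$\|I_{\Sigma_h^+}-H_{\Sigma_h^+}^{-1}A\|_A\le\rho_{\Sigma_h^+},\qquad\|I_{U_h}-H_{U_h}^{-1}S_{U_h,\eta}\|_{S_{U_h,\eta}}\le\rho_{U_h},\qquad H_{Q_h}\eqsim S_{Q_h,\eta},$$ and in addition that $$1+\rho_{\Sigma_h^+}+(1+\rho_{U_h})(1+2\rho_{\Sigma_h^+}+2\rho_{\Sigma_h^+}^2)<4.$$ Then, with $\mathcal H=\operatorname{diag}(H_{\Sigma_h^+},H_{U_h},H_{Q_h})$,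 the operator $\hat{\mathcal L}_{\eta,T}\bar{\mathcal A}_\eta$ satisfies the field-of-values conditions $$\inf_{\xi}\frac{(\xi,\hat{\mathcal L}_{\eta,T}\bar{\mathcal A}_\eta\xi)_{\mathcal H}}{(\xi,\xi)_{\mathcal H}}\gtrsim1,\qquad\sup_{\xi}\frac{\|\hat{\mathcal L}_{\eta,T}\bar{\mathcal A}_\eta\xi\|_{\mathcal H}}{\|\xi\|_{\mathcal H}}\lesssim1,$$ where $\xi$ ranges over the nonzero elements of $\Sigma_h^+\times U_h\times Q_h$.
   Context: Domain and mesh. $\Omega\subset\mathbb R^d$ ($d=2,3$) is a bounded polyhedral domain, $\mathcal T_h$ a quasi-uniform simplicial mesh of $\Omega$ with mesh size $h$, and $\mathcal F_h=\mathcal F_h^{\mathrm{int}}\cup\mathcal F_h^{\mathrm{bd}}$ its interior and boundary facets. Each interior facet $F$ carries a fixed unit normal $n=n_F$ pointing from the neighbouring element $T^+$ to the other neighbour $T^-$; on boundary facets $n$ is the outward unit normal. Jumps: $\llbracket z\rrbracket=z|_{T^+}-z|_{T^-}$ on interior facets, $\llbracket z\rrbracket=z|_T$ on boundary facets. For a vector $v$ and matrix $\tau$: $v_n=v\cdot n$, $v_t=v-v_nn$, $\tau_{nn}=n^T\tau n$, $\tau_{nt}=\tau n-\tau_{nn}n$. $\mathbb M=\mathbb R^{d\times d}$, $\mathbb K=\{\gamma\in\mathbb M:\gamma^T=-\gamma\}$, $\operatorname{dev}\varsigma=\varsigma-\frac1d(\operatorname{tr}\varsigma)I$. $\mathbb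 P^k(\mathcal T_h,X)$ denotes $X$-valued piecewise polynomials of degree $\le k$ (no interelement continuity). Spaces ($k\ge1$ integer). $V_h=H_0(\operatorname{div};\Omega)\cap\mathcal{RT}^k(\mathcal T_h)$, with local Raviart–Thomas space $\mathbb P^k(T,\mathbb R^d)+x\,\mathbb P^k(T)$; $Q_h=L^2_0(\Omega)\cap\mathbb P^k(\mathcal T_h)$ (zero mean); $W_h=\mathbb P^k(\mathcal T_h,\mathbb K)$; $U_h=V_h\times W_h$. Stress: $\Sigma_h=\{\tau\in\mathbb P^k(\mathcal T_h,\mathbb M):\operatorname{tr}\tau=0,\ \llbracket\tau_{nt}\rrbracket=0\ \forall F\in\mathcal F_h^{\mathrm{int}}\}$ and $\Sigma_h^+=\Sigma_h\oplus\delta\Sigma_h$, where $\delta\Sigma_h=\{\operatorname{dev}(\operatorname{curl}(\operatorname{curl}(r_h)B)):r_h\in\mathbb P^k_\perp(\mathcal T_h,\mathbb K)\}$, all operations elementwise; $\mathbb P_\perp^k(\mathcal T_h,\mathbb K)=\prod_T\mathbb P^k_\perp(T,\mathbb K)$ with $\mathbb P^k_\perp(T,\mathbb K)$ the $L^2(T)$-orthogonal complement of $\mathbb P^{k-1}(T,\mathbb K)$ in $\mathbb P^k(T,\mathbb K)$; with barycentric coordinates $\lambda_i$ of $T$, $B=\sum_{i=0}^3\lambda_{i-3}\lambda_{i-2}\lambda_{i-1}\nabla\lambda_i\otimes\nabla\lambda_i$ (indices mod 4) if $d=3$, $B=\lambda_0\lambda_1\lambda_2$ if $d=2$; $\operatorname{curl}$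 acts row-wise (for $d=2$ the inner curl maps the matrix to a vector, and the outer curl maps a vector field to the matrix whose rows are the rotated gradients of its components). Forms. $a(\varsigma,\tau)=\int_\Omega\nu^{-1}\operatorname{dev}\varsigma:\operatorname{dev}\tau\,dx$ on $\Sigma_h^+$; $b_1((v,\gamma),q)=\int_\Omega q\operatorname{div}v\,dx$ for $(v,\gamma)\in U_h$, $q\in Q_h$; $b_2(\tau,(v,\gamma))=-\sum_{T}\int_T\tau:(\nabla v-\gamma)\,dx+\sum_{F\in\mathcal F_h}\int_F\tau_{nt}\cdot\llbracket v_t\rrbracket\,ds$ for $\tau\in\Sigma_h^+$, $(v,\gamma)\in U_h$. Matrices. Finite element functions are identified with coefficient vectors in fixed bases; $(\cdot,\cdot)$ is the Euclidean inner product, $^T$ the Euclidean transpose. $(A\varsigma,\tau)=a(\varsigma,\tau)$, $(B_1(v,\gamma),q)=b_1((v,\gamma),q)$, $(B_2\tau,(v,\gamma))=b_2(\tau,(v,\gamma))$, $(M_{Q_h}q,r)=(q,r)_{L^2(\Omega)}$. For an SPD matrix $X$, $(x,y)_X=(Xx,y)$, $\|x\|_X=(x,x)_X^{1/2}$, and $\|\cdot\|_X$ applied to a square matrix is the induced operator norm. $I_{\Sigma_h^+},I_{U_h}$ are identities. For scalars, $x\lesssim y$ (equivalently $y\gtrsim x$) means $x\le Cy$ with $C>0$ independent of $\nu$ and $h$. For SPD matrices, $X\eqsim Y$ means $c(Yv,v)\le(Xv,v)\le C(Yv,v)$ for all $v$ with $c,C>0$ independent of $\nu$ and $h$. (The constants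 in the conclusion may depend on $\rho_{\Sigma_h^+},\rho_{U_h}$ and the constants in $H_{Q_h}\eqsim S_{Q_h,\eta}$.) *)

(* Defs.v *)
From HB Require Import structures.
From mathcomp Require Import all_boot all_order all_algebra.
From mathcomp Require Import all_classical all_reals all_analysis.
(* mpoly's notations clash with those of mathcomp-analysis *)
From mathcomp Require Import -(notations) mpoly.

Set Implicit Arguments.
Unset Strict Implicit.
Unset Printing Implicit Defensive.

Import Order.TTheory GRing.Theory Num.Theory.
Import numFieldNormedType.Exports.

Local Open Scope classical_set_scope.
Local Open Scope ring_scope.

(* Points of R^d are row vectors. *)

Section Euclidean.
Context {R : realType} {d : nat}.
Implicit Types (u v n x : 'rV[R]_d) (s t : 'M[R]_d).

Definition dot u v : R := (u *m v^T) 0 0.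

Definition enorm v : R := Num.sqrt (dot v v).

Definition diam (A : set 'rV[R]_d) : R :=
  sup [set r | exists x y, [/\ A x, A y & r = enorm (x - y)]].

Definition frob s t : R := \sum_i \sum_j s i j * t i j.

Definition dev s : 'M[R]_d := s - ((\tr s) / d%:R)%:M.

Definition tang n v : 'rV[R]_d := v - dot v n *: n.

(* [t] acts on column vectors, so the row vector of [t n] is [n *m t^T] *)
Definition nt n t : 'rV[R]_d :=
  n *m t^T - (n *m t *m n^T) 0 0 *: n.

(* convex hull of the points p i, i in A *)
Definition hull (I : finType) (p : I -> 'rV[R]_d) (A : {set I}) :
    set 'rV[R]_d :=
  [set x | exists w : I -> R,
    [/\ forall i, 0 <= w i, forall i, i \notin A -> w i = 0,
        \sum_i w i = 1 & x = \sum_i w i *: p i]].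

Definition affine_indep (I : finType) (p : I -> 'rV[R]_d) (A : {set I}) :=
  forall w : I -> R, (forall i, i \notin A -> w i = 0) ->
    \sum_i w i = 0 -> \sum_i w i *: p i = 0 -> forall i, w i = 0.

Definition polyhedral_domain (Omega : set 'rV[R]_d) :=
  [/\ connected Omega, Omega !=set0 &
      exists (m : nat) (p : 'I_m -> 'I_d.+1 -> 'rV[R]_d),
        (forall l, affine_indep (p l) [set: 'I_d.+1]%SET) /\
        Omega = interior (\bigcup_l hull (p l) [set: 'I_d.+1]%SET)].

End Euclidean.

Section Integrals.
Context {R : realType}.

(* Lebesgue integral over R^n as an iterated one-dimensional integral
   (Fubini-Tonelli). *)
Fixpoint iint (n : nat) : ('rV[R]_n -> \bar R) -> \bar R :=
  match n with
  | 0%N => fun f => f 0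
  | m.+1 => fun f =>
      (\int[@lebesgue_measure R]_t iint (fun y : 'rV[R]_m => f (row_mx t%:M y)))%E
  end.

Definition vol_int (n : nat) (D : set 'rV[R]_n) (f : 'rV[R]_n -> R) : R :=
  fine (iint (fun x => ((f \_ D) x)%:E)).

(* membership of g (restricted to D) in L^2(D) *)
Definition L2 (n : nat) (D : set 'rV[R]_n) (g : 'rV[R]_n -> R) :=
  measurable_fun [set: n.-tuple (measurableTypeR R)]
    (fun t => (g \_ D) (\row_i tnth t i) : measurableTypeR R) /\
  (iint (fun x => ((g \_ D) x ^+ 2)%:E) < +oo)%E.

(* Surface integral over the m-simplex with vertices s_0, ..., s_m of R^d, by
   the parametrization t |-> s_0 + sum_i t_i (s_{i+1} - s_0) of the reference
   simplex and its Gram determinant. *)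
Definition surf_int (d m : nat) (s : seq 'rV[R]_d) (f : 'rV[R]_d -> R) : R :=
  let J : 'M[R]_(m, d) := \matrix_(i < m) (s`_i.+1 - s`_0) in
  Num.sqrt (\det (J *m J^T)) *
  vol_int [set t : 'rV[R]_m | (forall i, 0 <= t 0 i) /\ \sum_i t 0 i <= 1]
    (fun t => f (s`_0 + t *m J)).

End Integrals.

Section Calculus.
Context {R : realType} {d : nat}.
Implicit Types (f : 'rV[R]_d -> R) (v : 'rV[R]_d -> 'rV[R]_d).

Definition partial (i : 'I_d) f (x : 'rV[R]_d) : R :=
  derive f x (delta_mx 0 i).

Definition grad f (x : 'rV[R]_d) : 'rV[R]_d := \row_i partial i f x.

Definition jac v (x : 'rV[R]_d) : 'M[R]_d :=
  \matrix_(i, j) partial j (fun y => v y 0 i) x.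

Definition div v (x : 'rV[R]_d) : R := \sum_i partial i (fun y => v y 0 i) x.

(* C^infinity on R^d *)
Definition smooth f :=
  forall s : seq 'I_d, let g := foldr partial f s in
    continuous g /\ forall i x, derivable g x (delta_mx 0 i).

(* Polynomial functions of total degree at most k; mmeasure mdeg p, i.e. msize p,
   is the total degree plus one. *)
Definition polyfun (k : nat) f :=
  exists p : mpoly d R, (mmeasure mdeg p <= k.+1)%N /\
    forall x, f x = meval (fun i => x 0 i) p.

Definition polymx (k m n : nat) (t : 'rV[R]_d -> 'M[R]_(m, n)) :=
  forall i j, polyfun k (fun x => t x i j).

Definition rt_local (k : nat) v :=
  exists (p : 'rV[R]_d -> 'rV[R]_d) (q : 'rV[R]_d -> R),
    [/\ polymx k p, polyfun k q & forall x, v x = p x + q x *: x].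

End Calculus.

Section CurlCurl.
Context {R : realType}.

(* In the next two definitions the nodes in A are the vertices of the simplex
   and lam its barycentric coordinates. *)

Definition curl_mv2 (r : 'rV[R]_2 -> 'M[R]_2) (x : 'rV[R]_2) : 'rV[R]_2 :=
  \row_i (partial 0 (fun y => r y i 1) x - partial 1 (fun y => r y i 0) x).

Definition curl_vm2 (w : 'rV[R]_2 -> 'rV[R]_2) (x : 'rV[R]_2) : 'M[R]_2 :=
  \matrix_(i, j) (if j == 0 then partial 1 (fun y => w y 0 i) x
                  else - partial 0 (fun y => w y 0 i) x).

Definition curlcurlB2 (N : nat) (A : {set 'I_N})
    (lam : 'I_N -> 'rV[R]_2 -> R) (r : 'rV[R]_2 -> 'M[R]_2) :
    'rV[R]_2 -> 'M[R]_2 :=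
  curl_vm2 (fun x => (\prod_(i in A) lam i x) *: curl_mv2 r x).

(* index arithmetic in 'I_3 is modulo 3 *)
Definition curl3 (r : 'rV[R]_3 -> 'M[R]_3) (x : 'rV[R]_3) : 'M[R]_3 :=
  \matrix_(i, j) (partial (j + 1) (fun y => r y i (j + 2%:R)) x -
                  partial (j + 2%:R) (fun y => r y i (j + 1)) x).

Definition bubble3 (N : nat) (A : {set 'I_N})
    (lam : 'I_N -> 'rV[R]_3 -> R) (x : 'rV[R]_3) : 'M[R]_3 :=
  \sum_(i in A) (\prod_(j in A | j != i) lam j x) *:
    ((grad (lam i) x)^T *m grad (lam i) x).

Definition curlcurlB3 (N : nat) (A : {set 'I_N})
    (lam : 'I_N -> 'rV[R]_3 -> R) (r : 'rV[R]_3 -> 'M[R]_3) :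
    'rV[R]_3 -> 'M[R]_3 :=
  curl3 (fun x => curl3 r x *m bubble3 A lam x).

(* curl (curl (r) B); the value for d <> 2, 3 is a dummy *)
Definition curlcurlB (d : nat) : forall (N : nat) (A : {set 'I_N})
    (lam : 'I_N -> 'rV[R]_d -> R) (r : 'rV[R]_d -> 'M[R]_d),
    'rV[R]_d -> 'M[R]_d :=
  match d with
  | 2%N => @curlcurlB2
  | 3%N => @curlcurlB3
  | _ => fun _ _ _ _ _ => 0
  end.

End CurlCurl.

(* An element is given by the set of its d+1 vertices, and a facet by the set
   of its d vertices. A mesh carries its facet orientations: mplus F is the
   element T^+ of F, and mnormal F the unit normal n_F, which is outward for
   T^+ (hence points to T^- on interior facets and out of the domain on
   boundary facets). *)
Record mesh (R : realType) (d : nat) (Omega : set 'rV[R]_d) := Mesh {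
  nnode : nat;
  node : 'I_nnode -> 'rV[R]_d;
  nelt : nat;
  elt : 'I_nelt -> {set 'I_nnode};
  facets : {set {set 'I_nnode}} :=
    [set F : {set 'I_nnode} | (#|F| == d) && [exists T, F \subset elt T]]%SET;
  mplus : {set 'I_nnode} -> 'I_nelt;
  mnormal : {set 'I_nnode} -> 'rV[R]_d;
  node_inj : injective node;
  elt_inj : injective elt;
  elt_card : forall T, #|elt T| = d.+1;
  elt_indep : forall T, affine_indep node (elt T);
  mesh_cover : \bigcup_T hull node (elt T) = closure Omega;
  mesh_conform : forall S T, hull node (elt S) `&` hull node (elt T) =
    hull node (elt S :&: elt T)%SET;
  mplusP : forall F, F \in facets -> F \subset elt (mplus F);
  mnormal_unit : forall F, F \in facets -> enorm (mnormal F) = 1;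
  mnormal_orth : forall F i j, F \in facets -> i \in F -> j \in F ->
    dot (mnormal F) (node i - node j) = 0;
  mnormal_out : forall F i j, F \in facets -> i \in F ->
    j \in elt (mplus F) -> j \notin F ->
    0 < dot (mnormal F) (node i - node j)
}.

Section FiniteElements.
Context {R : realType} {d : nat} {Omega : set 'rV[R]_d} (Th : mesh Omega).

Definition simplex (T : 'I_(nelt Th)) : set 'rV[R]_d := hull (@node _ _ _ Th) (elt T).

Definition mesh_size : R := \big[Num.max/0]_(T < nelt Th) diam (simplex T).

(* every element contains a ball of radius h / sigma, h being the (global) mesh
   size: shape regularity and quasi-uniformity in one condition *)
Definition quasi_uniform (sigma : R) :=
  forall T, exists c : 'rV[R]_d,
    [set x | enorm (x - c) < mesh_size / sigma] `<=` simplex T.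

(* the element T^- of an interior facet; None on boundary facets *)
Definition mminus (F : {set 'I_(nnode Th)}) : option 'I_(nelt Th) :=
  [pick T | (F \subset elt T) && (T != mplus F)].

Definition int_facets : {set {set 'I_(nnode Th)}} :=
  [set F in facets Th | mminus F != None]%SET.

Definition jump (Z : zmodType) (F : {set 'I_(nnode Th)})
    (z : 'I_(nelt Th) -> Z) : Z :=
  z (mplus F) - (if mminus F is Some T then z T else 0).

Definition facet_int (F : {set 'I_(nnode Th)}) (f : 'rV[R]_d -> R) : R :=
  surf_int d.-1 [seq node i | i <- enum F] f.

(* barycentric coordinates of x with respect to the vertices of T (0 at the
   other nodes) *)
Definition bary (T : 'I_(nelt Th)) (x : 'rV[R]_d) : 'I_(nnode Th) -> R :=
  xget (fun=> 0) [set w : 'I_(nnode Th) -> R |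
    [/\ forall i, i \notin elt T -> w i = 0, \sum_i w i = 1
      & x = \sum_i w i *: node i]].

(* Elementwise functions without interelement continuity. Only polynomials
   are used below, so the member on T is given as a function on all of R^d. *)
Definition broken (X : Type) := 'I_(nelt Th) -> 'rV[R]_d -> X.

Definition mesh_int (f : broken R) : R := \sum_T vol_int (simplex T) (f T).

(* H_0(div; Omega): the weak divergence g is in L^2 and the normal trace,
   defined by Green's formula, vanishes *)
Definition H0div (v : broken 'rV[R]_d) :=
  exists g : 'rV[R]_d -> R, L2 Omega g /\
    forall phi : 'rV[R]_d -> R, smooth phi ->
      mesh_int (fun T x => dot (v T x) (grad phi x)) =
      - vol_int Omega (fun x => g x * phi x).

Definition Vh (k : nat) : set (broken 'rV[R]_d) :=
  [set v | H0div v /\ forall T, rt_local k (v T)].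

Definition Qh (k : nat) : set (broken R) :=
  [set q | (forall T, polyfun k (q T)) /\ mesh_int q = 0].

Definition skew (t : 'M[R]_d) := t^T = - t.

Definition Wh (k : nat) : set (broken 'M[R]_d) :=
  [set c | forall T, polymx k (c T) /\ forall x, skew (c T x)].

Definition Uh (k : nat) : set (broken 'rV[R]_d * broken 'M[R]_d) :=
  [set u | Vh k u.1 /\ Wh k u.2].

Definition Sigmah (k : nat) : set (broken 'M[R]_d) :=
  [set t | (forall T, polymx k (t T) /\ forall x, \tr (t T x) = 0) /\
    forall F, F \in int_facets -> forall x, hull (@node _ _ _ Th) F x ->
      jump F (fun T => nt (mnormal F) (t T x)) = 0].

(* k.-1 is k - 1 for k >= 1 only *)
Definition Pperp (k : nat) : set (broken 'M[R]_d) :=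
  [set r | Wh k r /\
    forall T (s : 'rV[R]_d -> 'M[R]_d), polymx k.-1 s ->
      (forall x, skew (s x)) ->
      vol_int (simplex T) (fun x => frob (r T x) (s x)) = 0].

Definition deltaSigmah (k : nat) : set (broken 'M[R]_d) :=
  [set t | exists2 r : broken 'M[R]_d, Pperp k r &
    t = fun T x =>
      dev (curlcurlB (elt T) (fun i y => bary T y i) (r T) x)].

Definition Sigmah_plus (k : nat) : set (broken 'M[R]_d) :=
  [set t | exists s ds, [/\ Sigmah k s, deltaSigmah k ds & t = s + ds]].

Definition form_a (nu : R) (s t : broken 'M[R]_d) : R :=
  mesh_int (fun T x => nu^-1 * frob (dev (s T x)) (dev (t T x))).

Definition form_b1 (u : broken 'rV[R]_d * broken 'M[R]_d) (q : broken R) : R :=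
  mesh_int (fun T x => q T x * div (u.1 T) x).

(* The trace of t_nt is taken from T^+: t_nt is continuous across the interior
   facets for t in Sigma_h^+. *)
Definition form_b2 (t : broken 'M[R]_d)
    (u : broken 'rV[R]_d * broken 'M[R]_d) : R :=
  - mesh_int (fun T x => frob (t T x) (jac (u.1 T) x - u.2 T x)) +
  \sum_(F in facets Th) facet_int F (fun x =>
    dot (nt (mnormal F) (t (mplus F) x))
        (jump F (fun T => tang (mnormal F) (u.1 T x)))).

Definition form_m (q r : broken R) : R := mesh_int (fun T x => q T x * r T x).

End FiniteElements.

Definition is_basis (R : realType) (V : lmodType R) (S : set V) (n : nat)
    (phi : 'I_n -> V) :=
  (forall i, S (phi i)) /\
  forall f, S f -> exists! x : 'rV[R]_n, f = \sum_i x 0 i *: phi i.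

(* the matrix of (X f, g) = form f g in coefficients *)
Definition form_mx (R : realType) (V W : Type) (form : V -> W -> R) (m n : nat)
    (phi : 'I_n -> V) (psi : 'I_m -> W) : 'M[R]_(m, n) :=
  \matrix_(i, j) form (phi j) (psi i).

Section Matrices.
Context {R : realType}.

Definition mdot (n : nat) (X : 'M[R]_n) (x y : 'cV[R]_n) : R :=
  ((X *m x)^T *m y) 0 0.

Definition mnorm (n : nat) (X : 'M[R]_n) (x : 'cV[R]_n) : R :=
  Num.sqrt (mdot X x x).

Definition spd (n : nat) (X : 'M[R]_n) :=
  X^T = X /\ forall x, x != 0 -> 0 < mdot X x x.

Definition opnorm (n : nat) (X M : 'M[R]_n) : \bar R :=
  ereal_sup [set (mnorm X (M *m x) / mnorm X x)%:E | x in [set x | x != 0]].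

Definition spectral_equiv (n : nat) (c C : R) (X Y : 'M[R]_n) :=
  forall x, c * mdot Y x x <= mdot X x x <= C * mdot Y x x.

Definition SchurU (nS nU nQ : nat) (eta nu : R) (A : 'M[R]_nS)
    (B1 : 'M[R]_(nQ, nU)) (B2 : 'M[R]_(nU, nS)) (M : 'M[R]_nQ) : 'M[R]_nU :=
  B2 *m invmx A *m B2^T + (eta * nu) *: (B1^T *m invmx M *m B1).

(* invmx is the identity on singular matrices, so this is meaningful only for
   SU \in unitmx. *)
Definition SchurQ (nU nQ : nat) (SU : 'M[R]_nU) (B1 : 'M[R]_(nQ, nU)) :
    'M[R]_nQ :=
  B1 *m invmx SU *m B1^T.

Definition Abar (nS nU nQ : nat) (eta nu : R) (A : 'M[R]_nS)
    (B1 : 'M[R]_(nQ, nU)) (B2 : 'M[R]_(nU, nS)) (M : 'M[R]_nQ) :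
    'M[R]_(nS + (nU + nQ)) :=
  block_mx A (row_mx B2^T 0)
    (col_mx (- B2) 0)
    (block_mx ((eta * nu) *: (B1^T *m invmx M *m B1)) (- B1^T)
              B1 0).

Definition LhatT (nS nU nQ : nat) (HS : 'M[R]_nS) (HU : 'M[R]_nU)
    (HQ : 'M[R]_nQ) (B1 : 'M[R]_(nQ, nU)) (B2 : 'M[R]_(nU, nS)) :
    'M[R]_(nS + (nU + nQ)) :=
  invmx (block_mx HS 0 (col_mx (- B2) 0) (block_mx HU 0 B1 HQ)).

Definition Hdiag (nS nU nQ : nat) (HS : 'M[R]_nS) (HU : 'M[R]_nU)
    (HQ : 'M[R]_nQ) : 'M[R]_(nS + (nU + nQ)) :=
  block_mx HS 0 0 (block_mx HU 0 0 HQ).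

Definition fov_inf (n : nat) (H P : 'M[R]_n) : \bar R :=
  ereal_inf [set (mdot H x (P *m x) / mdot H x x)%:E | x in [set x | x != 0]].

Definition fov_sup (n : nat) (H P : 'M[R]_n) : \bar R :=
  ereal_sup [set (mnorm H (P *m x) / mnorm H x)%:E | x in [set x | x != 0]].

End Matrices.

(* Main.v *)
Require Import Defs.
From HB Require Import structures.
From mathcomp Require Import all_boot all_order all_algebra.
From mathcomp Require Import all_classical all_reals all_analysis.
From mathcomp Require Import measurable_realfun ring lra.
(* mpoly's notations clash with those of mathcomp-analysis *)
From mathcomp Require Import -(notations) mpoly.

Import Order.TTheory GRing.Theory Num.Theory.
Import numFieldNormedType.Exports.
Local Open Scope classical_set_scope.
Local Open Scope ring_scope.

(* With y = P (s, u, p) one has H_S y1 = A s + B2^T u and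
   H_U y2 = r - B1^T p for r = B2 (y1 - s) + D u, D = eta nu B1^T M^-1 B1, and
     ((s, u, p), y)_H = |s|_A^2 + |u|_D^2 + |y1|_{H_S}^2 - (s, y1)_A
                        - (B1^T p, r)_{H_U^-1} + |B1^T p|_{H_U^-1}^2.
   Since |r|_{H_U^-1}^2 <= (1 + rho_U) (|y1 - s|_A^2 + |u|_D^2), a Young inequality
   with weights 1 + rho_U and 1 / (1 + rho_U) absorbs both indefinite terms, and what
   is left dominates |(s, u, p)|_H^2 because A <= (1 + rho_S) H_S with rho_S < 1.
   This argument requires A to be positive definite and M positive semidefinite.
   Both are Gram matrices of piecewise polynomials: the iterated integral is linear
   and monotone on bounded measurable functions of bounded support, and a
   polynomial that vanishes on an open set is zero. *)

Section Preliminaries.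
Set Implicit Arguments.
Unset Strict Implicit.
Unset Printing Implicit Defensive.

(** * Quadratic forms *)

Section InnerProduct.

Context {R : realType}.

Definition ip {n : nat} (x y : 'cV[R]_n) : R := (x^T *m y) 0 0.

Lemma ipE n (x y : 'cV[R]_n) : ip x y = \sum_i x i 0 * y i 0.
Proof. by rewrite /ip mxE; apply: eq_bigr => i _; rewrite mxE. Qed.

Lemma ipC n (x y : 'cV[R]_n) : ip x y = ip y x.
Proof. by rewrite !ipE; apply: eq_bigr => i _; rewrite mulrC. Qed.

Lemma ipDr n (x y z : 'cV[R]_n) : ip x (y + z) = ip x y + ip x z.
Proof. by rewrite /ip mulmxDr mxE. Qed.

Lemma ipDl n (x y z : 'cV[R]_n) : ip (x + y) z = ip x z + ip y z.
Proof. by rewrite ipC ipDr ![ip _ z]ipC. Qed.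

Lemma ipNr n (x y : 'cV[R]_n) : ip x (- y) = - ip x y.
Proof. by rewrite /ip mulmxN mxE. Qed.

Lemma ipNl n (x y : 'cV[R]_n) : ip (- x) y = - ip x y.
Proof. by rewrite ipC ipNr ipC. Qed.

Lemma ipZr n a (x y : 'cV[R]_n) : ip x (a *: y) = a * ip x y.
Proof. by rewrite /ip -scalemxAr mxE. Qed.

Lemma ipZl n a (x y : 'cV[R]_n) : ip (a *: x) y = a * ip x y.
Proof. by rewrite ipC ipZr ipC. Qed.

Lemma ip_mulmx m n (M : 'M[R]_(m, n)) x y : ip (M *m x) y = ip x (M^T *m y).
Proof. by rewrite /ip trmx_mul mulmxA. Qed.

Definition ipl := (ipDr, ipDl, ipNr, ipNl, ipZr, ipZl).

Lemma mdotE n (X : 'M[R]_n) x y : mdot X x y = ip (X *m x) y.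
Proof. by []. Qed.

Definition psd n (X : 'M[R]_n) := X^T = X /\ forall x, 0 <= mdot X x x.

Lemma mdotC n (X : 'M[R]_n) x y : X^T = X -> mdot X x y = mdot X y x.
Proof. by move=> sX; rewrite !mdotE ip_mulmx sX ipC. Qed.

Lemma spd_psd n (X : 'M[R]_n) : spd X -> psd X.
Proof.
move=> [sX X0]; split=> // x; have [->|x0] := eqVneq x 0.
  by rewrite mdotE mulmx0 ipC /ip mulmx0 mxE.
exact: ltW (X0 _ x0).
Qed.

Lemma mdotB_sqr n (X : 'M[R]_n) x y : X^T = X ->
  mdot X (x - y) (x - y) = mdot X x x - 2 * mdot X x y + mdot X y y.
Proof.
move=> sX; have := @mdotC _ X x y sX; rewrite !mdotE mulmxBr !ipl => ->.
by ring.
Qed.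

Lemma mdot_le2D n (X : 'M[R]_n) x y : psd X ->
  mdot X (x - y) (x - y) <= 2 * (mdot X x x + mdot X y y).
Proof.
move=> [sX X0]; rewrite mdotB_sqr//.
have := X0 (x + y); have := @mdotC _ X x y sX.
by rewrite !mdotE mulmxDr !ipl => ->; lra.
Qed.

(** Nonnegativity of the form at [x - c *: y], divided by [c]. *)
Lemma mdot_young n (X : 'M[R]_n) c x y : psd X -> 0 < c ->
  2 * mdot X x y <= c^-1 * mdot X x x + c * mdot X y y.
Proof.
move=> [sX X0] c0; have := X0 (x - c *: y).
rewrite mdotB_sqr// !mdotE -scalemxAr !ipl -!mdotE.
by move=> h; rewrite -(ler_pM2l c0) (mulrDr c) mulVKf ?gt_eqF//; lra.
Qed.

Lemma spd_eq0 n (X : 'M[R]_n) x : spd X -> mdot X x x <= 0 -> x = 0.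
Proof.
move=> [_ X0]; have [//|x0] := eqVneq x 0.
by rewrite leNgt X0.
Qed.

Lemma spd_unitmx n (X : 'M[R]_n) : spd X -> X \in unitmx.
Proof.
move=> sX; rewrite -row_free_unit; apply/inj_row_free => v vX.
apply: trmx_inj; rewrite trmx0; apply: (spd_eq0 sX).
rewrite mdotE -[X in X *m _](proj1 sX) -trmx_mul vX trmx0.
by rewrite ipC /ip mulmx0 mxE.
Qed.

(** If [mdot X x x = 0], Young's inequality with arbitrarily small weight forces [mdot X x y = 0]
    for every [y], hence [X *m x = 0] and [x = 0]. *)
Lemma psd_unitmx_spd n (X : 'M[R]_n) : psd X -> X \in unitmx -> spd X.
Proof.
move=> pX uX; split; first exact: (proj1 pX).
move=> x x0; rewrite lt_neqAle (proj2 pX) andbT eq_sym; apply/eqP => xx.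
have Xx y : mdot X x y = 0.
  have h c : 0 < c -> 2 * mdot X x y <= c * mdot X y y.
    by move=> c0; have := mdot_young x y pX c0; rewrite xx mulr0 add0r.
  have h' c : 0 < c -> - (2 * mdot X x y) <= c * mdot X y y.
    move=> c0; have := mdot_young x (- y) pX c0.
    rewrite xx mulr0 add0r !mdotE mulmxN !ipl -!mdotE; lra.
  have yy := proj2 pX y.
  apply/eqP; rewrite -normr_le0; apply/ler_addgt0Pr => e e0; rewrite add0r.
  (* The weight is chosen so that [c * mdot X y y <= e]; the summand 1 keeps the denominator
     positive. *)
  have c0 : 0 < e / (mdot X y y + 1) by rewrite divr_gt0// ltr_wpDl.
  have ce : e / (mdot X y y + 1) * mdot X y y <= e.
    by rewrite -mulrA (ler_piMr (ltW e0))// mulrC ler_pdivrMr ?mul1r; lra.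
  have := h _ c0; have := h' _ c0; rewrite ler_norml; lra.
case/negP: x0; rewrite -(mulKmx uX x); apply/eqP.
suff -> : X *m x = 0 by rewrite mulmx0.
apply/matrixP => i j; rewrite (ord1 j) [RHS]mxE.
have := Xx (delta_mx i 0); rewrite mdotE ipE (bigD1 i)//= big1 => [|k ki].
  by rewrite addr0 [X in _ * X]mxE !eqxx mulr1 => ->.
by rewrite [X in _ * X]mxE (negPf ki) mulr0.
Qed.

Lemma mdot_invmx n (X : 'M[R]_n) x : spd X ->
  mdot (invmx X) (X *m x) (X *m x) = mdot X x x.
Proof. by move=> sX; rewrite !mdotE (mulKmx (spd_unitmx sX)) ipC. Qed.

Lemma spd_invmx n (X : 'M[R]_n) : spd X -> spd (invmx X).
Proof.
move=> sX; split; first by rewrite trmx_inv (proj1 sX).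
move=> x x0; rewrite -(mulKVmx (spd_unitmx sX) x) mdot_invmx//.
apply: (proj2 sX); apply: contraNneq x0 => Xx.
by rewrite -(mulKVmx (spd_unitmx sX) x) Xx mulmx0.
Qed.

(* Also true for singular [X], for which [invmx X = X]. *)
Lemma psd_invmx n (X : 'M[R]_n) : psd X -> psd (invmx X).
Proof.
move=> pX; have [uX|nuX] := boolP (X \in unitmx).
  exact: spd_psd (spd_invmx (psd_unitmx_spd pX uX)).
by rewrite invmx_out// inE.
Qed.

(** Young's inequality for the pairing of the norms of [X] and [invmx X]: write [b] as [X] applied
    to [invmx X *m b]. *)
Lemma ip_young n (X : 'M[R]_n) c b e : spd X -> 0 < c ->
  2 * ip b e <= c^-1 * mdot (invmx X) b b + c * mdot X e e.
Proof.
move=> sX c0; rewrite -(mulKVmx (spd_unitmx sX) b) mdot_invmx//.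
exact: mdot_young (spd_psd sX) c0.
Qed.

(** Inversion reverses the order of SPD matrices. For [z = invmx Y *m y], both [ip y z] and
    [mdot Y z z] equal [mdot (invmx Y) y y], and Young's inequality with weight [c^-1] bounds
    [2 * ip y z] by [c * mdot (invmx X) y y + mdot Y z z]. *)
Lemma mdot_invmx_le n (X Y : 'M[R]_n) c : spd X -> spd Y -> 0 < c ->
  (forall x, mdot X x x <= c * mdot Y x x) ->
  forall y, mdot (invmx Y) y y <= c * mdot (invmx X) y y.
Proof.
move=> sX sY c0 XY y.
have ci0 : 0 < c^-1 by rewrite invr_gt0.
have := ip_young y (invmx Y *m y) sX ci0; rewrite invrK.
rewrite [ip y _]ipC -mdotE => h.
have := XY (invmx Y *m y); rewrite -(ler_pM2l ci0) mulKf ?gt_eqF//.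
by rewrite [mdot Y _ _]mdotE (mulKVmx (spd_unitmx sY)) [ip y _]ipC -mdotE; lra.
Qed.

(** The norm bound on [T] gives [|(T x, x)_A| <= rho * |x|_A^2]. Read at [y = A x], this compares
    [invmx H] with [invmx A], and inversion compares [A] with [H]. *)
Lemma opnorm_spectral n (A H : 'M[R]_n) rho :
  spd A -> spd H -> 0 <= rho -> rho < 1 ->
  (opnorm A (1%:M - invmx H *m A) <= rho%:E)%E ->
  forall x, (1 - rho) * mdot H x x <= mdot A x x <= (1 + rho) * mdot H x x.
Proof.
move=> sA sH rho0 rho1 Hop.
set T := 1%:M - _ in Hop.
have pA := spd_psd sA.
have Tx x : mdot A (T *m x) (T *m x) <= rho ^+ 2 * mdot A x x.
  have [->|x0] := eqVneq x 0.
    by rewrite mulmx0 !mdotE mulmx0 ipC /ip mulmx0 mxE mulr0.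
  have Ax := proj2 sA _ x0.
  have : ((mnorm A (T *m x) / mnorm A x)%:E <= rho%:E)%E.
    by apply: le_trans Hop; apply: ereal_sup_ubound; exists x.
  have nx : 0 < mnorm A x by rewrite sqrtr_gt0.
  rewrite lee_fin ler_pdivrMr// => h.
  rewrite -(sqr_sqrtr (proj2 pA (T *m x))) -[X in _ * X](sqr_sqrtr (ltW Ax)).
  by rewrite -exprMn ler_sqr ?nnegrE ?sqrtr_ge0// mulr_ge0// sqrtr_ge0.
have ATx x : `|mdot A (T *m x) x| <= rho * mdot A x x.
  (* Young's inequality is used with weight [rho], which must be positive; for [rho = 0] the vector
     [T *m x] itself vanishes. *)
  have Tx0 := Tx x; move: rho0; rewrite le_eqVlt => /predU1P[r0|r0].
    have -> : T *m x = 0 by apply: (spd_eq0 sA); move: Tx0; rewrite -r0 expr0n mul0r.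
    by rewrite mdotE mulmx0 ipC /ip mulmx0 mxE -r0 mul0r normr0.
  have rT : rho^-1 * mdot A (T *m x) (T *m x) <= rho * mdot A x x.
    by rewrite mulrC ler_pdivrMr// mulrAC -expr2.
  have h1 := mdot_young (T *m x) x pA r0.
  have h2 := mdot_young (T *m x) (- x) pA r0.
  rewrite ler_norml; move: h2; rewrite !mdotE mulmxN !ipl -!mdotE; lra.
(* For [y = A *m x] one has [mdot (invmx H) y y = mdot A x x - mdot A (T *m x) x]. *)
have key y : (1 - rho) * mdot (invmx A) y y <= mdot (invmx H) y y
           <= (1 + rho) * mdot (invmx A) y y.
  rewrite -(mulKVmx (spd_unitmx sA) y) mdot_invmx//; set x := invmx A *m y.
  have := ATx x; rewrite mdotE /T mulmxBl mul1mx mulmxBr !ipl -mdotE.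
  rewrite ip_mulmx (proj1 sA) -mulmxA -mdotE ler_norml; lra.
have uA := spd_unitmx sA; have uH := spd_unitmx sH.
have sAi := spd_invmx sA; have sHi := spd_invmx sH.
move=> x; apply/andP; split.
  have r0 : 0 < (1 - rho)^-1 by rewrite invr_gt0; lra.
  have := @mdot_invmx_le _ _ _ _ sAi sHi r0 _ x; rewrite !invmxK => h.
  rewrite mulrC -ler_pdivlMr; last by lra.
  rewrite mulrC; apply: h => y; rewrite mulrC ler_pdivlMr; last by lra.
  by rewrite mulrC; have /andP[] := key y.
have r0 : 0 < 1 + rho by lra.
have := @mdot_invmx_le _ _ _ _ sHi sAi r0 _ x; rewrite !invmxK; apply => y.
by have /andP[] := key y.
Qed.

End InnerProduct.

(** * The block triangular preconditioner *)

Section BlockSystem.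

Context {R : realType} {nS nU nQ : nat}.
Context {A HS : 'M[R]_nS} {D HU : 'M[R]_nU} {HQ : 'M[R]_nQ}.
Context {B1 : 'M[R]_(nQ, nU)} {B2 : 'M[R]_(nU, nS)} {a b cQ CQ : R}.
(** The Schur complement [SchurU] with its second summand abstracted to a positive semidefinite [D];
    [a] and [b] stand for the two contraction bounds [rhoS] and [rhoU]. *)
Let S := B2 *m invmx A *m B2^T + D.
Context (sA : spd A) (pD : psd D) (sHS : spd HS) (sHU : spd HU) (sHQ : spd HQ).
Context (uS : S \in unitmx).
Context (a0 : 0 <= a) (a1 : a < 1) (b0 : 0 <= b) (b1 : b < 1).
Context (cQ0 : 0 < cQ) (CQ0 : 0 < CQ).
Context (HSA : (opnorm A (1%:M - invmx HS *m A) <= a%:E)%E).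
Context (HUS : (opnorm S (1%:M - invmx HU *m S) <= b%:E)%E).
Context (HQS : spectral_equiv cQ CQ HQ (SchurQ S B1)).


Lemma schurE x : mdot S x x = mdot (invmx A) (B2^T *m x) (B2^T *m x) + mdot D x x.
Proof.
by rewrite /S !mdotE mulmxDl !ipl -!mulmxA ip_mulmx.
Qed.

(** A sum of positive semidefinite matrices, definite because it is invertible. *)
Lemma schur_spd : spd S.
Proof.
apply: psd_unitmx_spd uS; split.
  rewrite /S linearD/= !trmx_mul trmxK mulmxA (proj1 (spd_invmx sA)).
  by rewrite (proj1 pD).
move=> x; rewrite schurE addr_ge0 ?(proj2 pD)//.
exact: (proj2 (spd_psd (spd_invmx sA))).
Qed.

Let AHS x : (1 - a) * mdot HS x x <= mdot A x x <= (1 + a) * mdot HS x x.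
Proof. exact: opnorm_spectral. Qed.

Let SHU x : (1 - b) * mdot HU x x <= mdot S x x <= (1 + b) * mdot HU x x.
Proof. exact: opnorm_spectral schur_spd _ _ _ _ _. Qed.

(** This and the next three bounds are [SHU] and [AHS] carried over to the inverses, that is, to the
    dual norms. *)
Let invHU_le x : mdot (invmx HU) x x <= (1 + b) * mdot (invmx S) x x.
Proof.
have c0 : 0 < 1 + b by move: a0 a1 b0 b1; lra.
by apply: (mdot_invmx_le schur_spd sHU c0) => y; case/andP: (SHU y).
Qed.

Let invHS_le x : mdot (invmx HS) x x <= (1 + a) * mdot (invmx A) x x.
Proof.
have c0 : 0 < 1 + a by move: a0 a1 b0 b1; lra.
by apply: (mdot_invmx_le sA sHS c0) => y; case/andP: (AHS y).
Qed.

Let invA_le x : (1 - a) * mdot (invmx A) x x <= mdot (invmx HS) x x.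
Proof.
have c0 : 0 < 1 - a by move: a0 a1 b0 b1; lra.
have ci0 : 0 < (1 - a)^-1 by rewrite invr_gt0.
rewrite mulrC -ler_pdivlMr// mulrC; apply: (mdot_invmx_le sHS sA ci0) => y.
by rewrite mulrC ler_pdivlMr// mulrC; case/andP: (AHS y).
Qed.

Let invS_le x : (1 - b) * mdot (invmx S) x x <= mdot (invmx HU) x x.
Proof.
have c0 : 0 < 1 - b by move: a0 a1 b0 b1; lra.
have ci0 : 0 < (1 - b)^-1 by rewrite invr_gt0.
rewrite mulrC -ler_pdivlMr// mulrC.
apply: (mdot_invmx_le sHU schur_spd ci0) => y.
by rewrite mulrC ler_pdivlMr// mulrC; case/andP: (SHU y).
Qed.

(* With [v = S^-1 r], the claim reads [(v, r) <= |e|_A^2 + |u|_D^2]; Young's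
   inequality bounds [2 (v, r)] by [(S v, v)] plus the right-hand side. *)
Lemma invmx_schur_le e u :
  mdot (invmx S) (B2 *m e + D *m u) (B2 *m e + D *m u) <= mdot A e e + mdot D u u.
Proof.
set r := _ + _; set v := invmx S *m r.
have Sv : S *m v = r by rewrite mulKVmx.
have vr : mdot (invmx S) r r = ip v r by [].
have Svv : mdot S v v = ip v r by rewrite mdotE Sv ipC.
have vr2 : ip v r = ip (B2^T *m v) e + mdot D u v.
  by rewrite /r ipDr [in RHS]ip_mulmx trmxK [ip v (D *m u)]ipC -mdotE.
have := ip_young (B2^T *m v) e sA ltr01; rewrite invr1 !mul1r.
have := mdot_young u v pD ltr01; rewrite invr1 !mul1r.
have := schurE v; rewrite vr Svv; move: a0 a1 b0 b1; lra.
Qed.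

Let schurQE p : mdot (SchurQ S B1) p p = mdot (invmx S) (B1^T *m p) (B1^T *m p).
Proof. by rewrite /SchurQ !mdotE -!mulmxA ip_mulmx. Qed.

(** [(y1, y2, y3)] is the image of [(s, u, p)] under the preconditioned operator; [E1], [E2], [E3]
    are the rows of the forward substitution that computes it. *)
Context {s y1 : 'cV[R]_nS} {u y2 : 'cV[R]_nU} {p y3 : 'cV[R]_nQ}.
Context (E1 : HS *m y1 = A *m s + B2^T *m u).
Context (E2 : HU *m y2 = B2 *m (y1 - s) + D *m u - B1^T *m p).
Context (E3 : HQ *m y3 = B1 *m (u - y2)).

Let r := B2 *m (y1 - s) + D *m u.
Let q := mdot (invmx HU) (B1^T *m p) (B1^T *m p).

Let r_le : mdot (invmx HU) r r
  <= (1 + b) * (mdot A s s - 2 * mdot A s y1 + mdot A y1 y1 + mdot D u u).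
Proof.
apply: le_trans (invHU_le _) _; rewrite ler_pM2l; last by move: b0; lra.
apply: le_trans (invmx_schur_le _ _) _.
by rewrite mdotB_sqr ?(proj1 sA)// (mdotC _ _ (proj1 sA)); move: a0 a1 b0 b1; lra.
Qed.

(** By [E1], [B2^T *m u = HS *m y1 - A *m s]. The lower bound on the inner product contains only the
    [D]-part of the norm of [u]; the rest of [mdot S u u] is recovered here from [s] and [y1]. *)
Let B2u_le : mdot (invmx A) (B2^T *m u) (B2^T *m u)
  <= 2 * (mdot A s s + (1 - a)^-1 * mdot HS y1 y1).
Proof.
have -> : B2^T *m u = HS *m y1 - A *m s by rewrite E1 addrC addKr.
apply: le_trans (mdot_le2D _ _ (spd_psd (spd_invmx sA))) _.
rewrite ler_pM2l// addrC mdot_invmx// lerD2l -(mdot_invmx y1 sHS).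
by rewrite mulrC ler_pdivlMr 1?mulrC ?invA_le//; move: a0 a1 b0 b1; lra.
Qed.

Lemma block_inner_ge :
  2^-1 * (mdot A s s + mdot D u u + (1 - a) * mdot HS y1 y1 + (1 - b) * q)
  <= mdot HS s y1 + mdot HU u y2 + mdot HQ p y3.
Proof.
(* The three inner products are expanded one by one. In their sum the couplings [ip s (B2^T *m u)]
   and [ip p (B1 *m u)] each occur with both signs and cancel. *)
have -> : mdot HS s y1 = mdot A s s + ip s (B2^T *m u).
  by rewrite (mdotC _ _ (proj1 sHS)) mdotE E1 ipDl -mdotE ipC [ip s _]ipC.
have -> : mdot HQ p y3 = ip p (B1 *m u) - ip p (B1 *m y2).
  by rewrite (mdotC _ _ (proj1 sHQ)) mdotE E3 mulmxBr ipDl ipNl !(ipC p).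
have -> : mdot HU u y2 = ip u (B2 *m y1) - ip u (B2 *m s) + mdot D u u
                         - ip p (B1 *m u).
  rewrite (mdotC _ _ (proj1 sHU)) mdotE E2 (mulmxBr B2) !ipl -mdotE.
  rewrite [ip (B1^T *m p) u]ip_mulmx trmxK !(ipC u); lra.
have -> : ip u (B2 *m s) = ip s (B2^T *m u) by rewrite ipC ip_mulmx.
have -> : ip u (B2 *m y1) = mdot HS y1 y1 - mdot A s y1.
  by rewrite ipC ip_mulmx ipC !mdotE E1 ipDl; ring.
have -> : ip p (B1 *m y2) = mdot (invmx HU) (B1^T *m p) r - q.
  rewrite /q ipC ip_mulmx !mdotE -(mulKmx (spd_unitmx sHU) y2) E2 -/r.
  rewrite mulmxBr !ipl [ip (invmx HU *m r) _]ip_mulmx (proj1 (spd_invmx sHU)).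
  by rewrite (ipC r) /r ipDr.
have t0 : 0 < 1 + b by move: b0; lra.
have ti0 : 0 < (1 + b)^-1 by rewrite invr_gt0.
(* The weight [(1 + b)^-1] removes the factor [1 + b] of [r_le]. The term [mdot A s y1] then cancels
   exactly, [q] keeps the coefficient [(1 - b) / 2], and [mdot A y1 y1 <= (1 + a) * mdot HS y1 y1]
   leaves [(1 - a) / 2] for [y1]. *)
have := mdot_young (B1^T *m p) r (spd_psd (spd_invmx sHU)) ti0.
have := r_le; rewrite -(ler_pM2l ti0) mulKf ?gt_eqF// invrK -/q.
have /andP[_] := AHS y1; lra.
Qed.

Let schurQ_le : mdot (invmx S) (B1^T *m p) (B1^T *m p) <= cQ^-1 * mdot HQ p p.
Proof.
rewrite -schurQE mulrC ler_pdivlMr// mulrC.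
by have /andP[] := HQS p.
Qed.

Let mdot_ge0 n (X : 'M[R]_n) x : spd X -> 0 <= mdot X x x.
Proof. by move=> /spd_psd[]. Qed.

(** The norm of [s] is compared through [AHS], that of [u] through [SHU], [schurE] and [B2u_le], and
    that of [p] through [HQS] and the dual bound [invS_le]. *)
Lemma block_norm_le :
  mdot HS s s + mdot HU u u + mdot HQ p p <=
  (3 / ((1 - a) ^+ 2 * (1 - b)) + CQ / (1 - b) ^+ 2) *
  (mdot A s s + mdot D u u + (1 - a) * mdot HS y1 y1 + (1 - b) * q).
Proof.
have c0 : 0 < 1 - a by move: a1; lra.
have d0 : 0 < 1 - b by move: b1; lra.
rewrite invfM -!exprVn.
set Y := _ * mdot HS _ _; set q' := _ * q.
set ia := (1 - a)^-1; set ib := (1 - b)^-1.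
have ia1 : 1 <= ia by rewrite invf_ge1//; move: a0; lra.
have ib1 : 1 <= ib by rewrite invf_ge1//; move: b0; lra.
have YE : mdot HS y1 y1 = ia * Y by rewrite /Y mulKf ?gt_eqF.
have qE : q = ib * q' by rewrite /q' mulKf ?gt_eqF.
have Y0 : 0 <= Y by rewrite mulr_ge0 ?mdot_ge0// ltW.
have q0 : 0 <= q' by rewrite mulr_ge0 ?mdot_ge0 ?ltW//; apply: spd_invmx.
have sA0 := mdot_ge0 s sA; have uD0 := proj2 pD u.
have sH : mdot HS s s <= ia * mdot A s s.
  by rewrite mulrC ler_pdivlMr// mulrC; case/andP: (AHS s).
have uH : mdot HU u u <= ib * (2 * (mdot A s s + ia * (ia * Y)) + mdot D u u).
  rewrite mulrC ler_pdivlMr// mulrC; case/andP: (SHU u) => /le_trans + _.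
  by apply; rewrite schurE lerD2r -YE B2u_le.
have pH : mdot HQ p p <= CQ * (ib * (ib * q')).
  case/andP: (HQS p) => _ /le_trans; apply; rewrite schurQE ler_pM2l// -qE.
  by rewrite mulrC ler_pdivlMr// mulrC invS_le.
have ia2 : ia <= ia ^+ 2 by rewrite ler_eXnr.
have iab : ia ^+ 2 <= ia ^+ 2 * ib by rewrite ler_peMr// sqr_ge0.
have iba : ib <= ia ^+ 2 * ib by rewrite ler_peMl ?exprn_ege1//; lra.
(* [K = ia ^+ 2 * ib] dominates both [ia] and [ib], as these are at least 1. The coefficient of
   [mdot A s s] is [ia + 2 * ib <= 3 * K], whence the 3 in the constant. *)
set K := _ * ib in iab iba *.
apply: (le_trans (lerD (lerD sH uH) pH)).
have -> : ib * (2 * (mdot A s s + ia * (ia * Y)) + mdot D u u)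
  = 2 * (ib * mdot A s s) + 2 * (K * Y) + ib * mdot D u u by rewrite /K; ring.
have h1 : ib * mdot A s s <= K * mdot A s s by rewrite ler_wpM2r.
have h2 : ib * mdot D u u <= K * mdot D u u by rewrite ler_wpM2r.
have h3 : ia * mdot A s s <= K * mdot A s s.
  by rewrite ler_wpM2r// (le_trans ia2).
have K0 : 0 <= K by lra.
have h4 : 0 <= K * mdot D u u by rewrite mulr_ge0.
have h5 : 0 <= K * Y by rewrite mulr_ge0.
have h6 : 0 <= K * q' by rewrite mulr_ge0.
have C0 : 0 <= CQ * ib ^+ 2 by rewrite mulr_ge0 ?sqr_ge0// ltW.
have h7 : 0 <= CQ * ib ^+ 2 * mdot A s s by rewrite mulr_ge0.
have h8 : 0 <= CQ * ib ^+ 2 * mdot D u u by rewrite mulr_ge0.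
have h9 : 0 <= CQ * ib ^+ 2 * Y by rewrite mulr_ge0.
rewrite (mulrA ib) -expr2; lra.
Qed.

(** Forward substitution: [y1] is bounded from [E1], then [y2] from [E2], then [y3] from [E3]. With
    [1 + a] and [1 + b] replaced by 2, the three bounds are [8], [152 + 4 / cQ] and
    [4 / cQ * (153 + 4 / cQ)] times the norm of [(s, u, p)]. *)
Lemma block_image_le :
  mdot HS y1 y1 + mdot HU y2 y2 + mdot HQ y3 y3 <=
  (160 + 4 / cQ + 4 / cQ * (153 + 4 / cQ)) *
  (mdot HS s s + mdot HU u u + mdot HQ p p).
Proof.
set X := (X in _ <= _ * X).
have sH0 := mdot_ge0 s sHS; have uH0 := mdot_ge0 u sHU.
have pH0 := mdot_ge0 p sHQ; have yH0 := mdot_ge0 y1 sHS.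
have a2 : 1 + a <= 2 by move: a1; lra.
have b2 : 1 + b <= 2 by move: b1; lra.
have sA2 : mdot A s s <= 2 * mdot HS s s.
  have /andP[_ /le_trans] := AHS s; apply; exact: ler_wpM2r.
have yA2 : mdot A y1 y1 <= 2 * mdot HS y1 y1.
  have /andP[_ /le_trans] := AHS y1; apply; exact: ler_wpM2r.
have uS2 : mdot S u u <= 2 * mdot HU u u.
  have /andP[_ /le_trans] := SHU u; apply; exact: ler_wpM2r.
have uD0 := proj2 pD u.
have uB0 := mdot_ge0 (B2^T *m u) (spd_invmx sA).
have yH : mdot HS y1 y1 <= 8 * X.
  rewrite -(mdot_invmx y1 sHS) E1 (le_trans (invHS_le _))//.
  have h := mdot_le2D (A *m s) (- (B2^T *m u)) (spd_psd (spd_invmx sA)).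
  move: h; rewrite opprK (mdot_invmx s sA) [mdot _ (- _) _]mdotE mulmxN !ipl.
  rewrite opprK -mdotE.
  set Z := mdot _ _ _ => h.
  have Z0 : 0 <= Z by apply: mdot_ge0; apply: spd_invmx.
  apply: (@le_trans _ _ (2 * Z)); first exact: ler_wpM2r.
  by move: uS2; rewrite schurE /X; lra.
have q2 : q <= 2 / cQ * X.
  have h := invHU_le (B1^T *m p); have h2 := schurQ_le.
  have h0 := mdot_ge0 (B1^T *m p) (spd_invmx schur_spd).
  apply: (le_trans h).
  apply: (@le_trans _ _ (2 * mdot (invmx S) (B1^T *m p) (B1^T *m p))).
    exact: ler_wpM2r.
  rewrite -mulrA ler_pM2l// (le_trans h2)// ler_pM2l ?invr_gt0//.
  by rewrite /X; lra.
have r2 : mdot (invmx HU) r r <= 76 * X.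
  apply: (le_trans (invHU_le _)).
  have h := invmx_schur_le (y1 - s) u.
  have h0 := mdot_ge0 r (spd_invmx schur_spd).
  apply: (@le_trans _ _ (2 * mdot (invmx S) r r)); first exact: ler_wpM2r.
  have := mdot_le2D y1 s (spd_psd sA).
  by move: uS2 h; rewrite schurE /X -/r; rewrite /X in yH; lra.
have y2H : mdot HU y2 y2 <= (152 + 4 / cQ) * X.
  rewrite -(mdot_invmx y2 sHU) E2 -/r.
  have := mdot_le2D r (B1^T *m p) (spd_psd (spd_invmx sHU)).
  rewrite -/q; lra.
have y3H : mdot HQ y3 y3 <= 4 / cQ * (mdot HU u u + mdot HU y2 y2).
  have ci0 : 0 < cQ^-1 by rewrite invr_gt0.
  (* With weight [cQ^-1] the first term on the right is at most [mdot HQ y3 y3] and is absorbed on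
     the left. *)
  have h : 2 * mdot HQ y3 y3
      <= cQ * mdot (SchurQ S B1) y3 y3 + cQ^-1 * mdot S (u - y2) (u - y2).
    rewrite mdotE E3 ip_mulmx schurQE ipC.
    have := ip_young (B1^T *m y3) (u - y2) schur_spd ci0.
    by rewrite invrK.
  have h1 : mdot HQ y3 y3 <= cQ^-1 * mdot S (u - y2) (u - y2).
    by have /andP[+ _] := HQS y3; lra.
  apply: (le_trans h1); rewrite -mulrA mulrCA ler_pM2l//.
  have h2 := mdot_le2D u y2 (spd_psd sHU).
  have /andP[_ h3] := SHU (u - y2).
  apply: (le_trans h3).
  apply: (@le_trans _ _ (2 * mdot HU (u - y2) (u - y2))); last by lra.
  apply: ler_wpM2r => //; exact: mdot_ge0.
have y3H' : mdot HQ y3 y3 <= 4 / cQ * ((153 + 4 / cQ) * X).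
  apply: (le_trans y3H); apply: ler_wpM2l; first by rewrite divr_ge0// ltW.
  by rewrite [in X in _ <= X]mulrDl in y2H *; rewrite /X in y2H *; lra.
rewrite [leRHS]mulrDl -mulrA; lra.
Qed.

End BlockSystem.

(** * Field-of-values bounds for the block operator *)

Lemma mdot_Hdiag (R : realType) nS nU nQ (HS : 'M[R]_nS) (HU : 'M[R]_nU)
    (HQ : 'M[R]_nQ) s u p y1 y2 y3 :
  mdot (Hdiag HS HU HQ) (col_mx s (col_mx u p)) (col_mx y1 (col_mx y2 y3)) =
  mdot HS s y1 + mdot HU u y2 + mdot HQ p y3.
Proof.
rewrite /mdot /Hdiag !mul_block_col !mul0mx !addr0 !add0r !tr_col_mx.
by rewrite !mul_row_col !mxE addrA.
Qed.

(** The vector on the left is the block lower triangular matrix applied to [(y1, y2, y3)]; that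
    matrix is invertible because its diagonal blocks are. *)
Lemma LhatT_mulmx (R : realType) nS nU nQ (HS : 'M[R]_nS) (HU : 'M[R]_nU)
    (HQ : 'M[R]_nQ) (B1 : 'M[R]_(nQ, nU)) (B2 : 'M[R]_(nU, nS))
    (y1 : 'cV[R]_nS) (y2 : 'cV[R]_nU) (y3 : 'cV[R]_nQ) :
  HS \in unitmx -> HU \in unitmx -> HQ \in unitmx ->
  LhatT HS HU HQ B1 B2 *m
    col_mx (HS *m y1) (col_mx (HU *m y2 - B2 *m y1) (B1 *m y2 + HQ *m y3)) =
  col_mx y1 (col_mx y2 y3).
Proof.
move=> uS uU uQ; rewrite /LhatT; set L := block_mx _ _ _ _.
have uL : L \in unitmx.
  by rewrite unitmxE !det_lblock !unitrM -!unitmxE uS uU uQ.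
rewrite -[RHS](mulKmx uL); congr (_ *m _).
rewrite /L !mul_block_col !mul0mx !addr0 mul_col_mx mul0mx mulNmx.
by rewrite add_col_mx add0r addrC.
Qed.

(** The constants are chosen before the dimensions and the matrices; this is the source of the
    independence of [nu] and [h]. *)
Lemma block_triangular_fov (R : realType) (a b cQ CQ : R) :
  0 <= a < 1 -> 0 <= b < 1 -> 0 < cQ -> 0 < CQ ->
  exists c C : R, [/\ 0 < c, 0 < C &
    forall nS nU nQ (A HS : 'M[R]_nS) (D HU : 'M[R]_nU) (HQ : 'M[R]_nQ)
      (B1 : 'M[R]_(nQ, nU)) (B2 : 'M[R]_(nU, nS)),
    let S := B2 *m invmx A *m B2^T + D in
    spd A -> psd D -> spd HS -> spd HU -> spd HQ -> S \in unitmx ->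
    (opnorm A (1%:M - invmx HS *m A) <= a%:E)%E ->
    (opnorm S (1%:M - invmx HU *m S) <= b%:E)%E ->
    spectral_equiv cQ CQ HQ (SchurQ S B1) ->
    let P := LhatT HS HU HQ B1 B2 *m
      block_mx A (row_mx B2^T 0) (col_mx (- B2) 0) (block_mx D (- B1^T) B1 0) in
    let H := Hdiag HS HU HQ in
    (c%:E <= fov_inf H P)%E /\ (fov_sup H P <= C%:E)%E].
Proof.
move=> /andP[a0 a1] /andP[b0 b1] cQ0 CQ0.
pose K := 3 / ((1 - a) ^+ 2 * (1 - b)) + CQ / (1 - b) ^+ 2.
pose L := 160 + 4 / cQ + 4 / cQ * (153 + 4 / cQ).
have a1' : 0 < 1 - a by lra.
have b1' : 0 < 1 - b by lra.
have K0 : 0 < K by rewrite addr_gt0 ?divr_gt0 ?mulr_gt0 ?exprn_gt0.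
have ci : 0 < 4 / cQ by rewrite divr_gt0.
have L0 : 0 < L.
  have : 0 < 4 / cQ * (153 + 4 / cQ) by rewrite mulr_gt0//; lra.
  by rewrite /L; lra.
(* [K] is the constant of [block_norm_le], and the 2 comes from the factor [2^-1] of
   [block_inner_ge]; [L] is the constant of [block_image_le], which bounds squared norms. *)
exists (2 * K)^-1, (Num.sqrt L).
split; [by rewrite invr_gt0 mulr_gt0|by rewrite sqrtr_gt0|].
move=> nS nU nQ A HS D HU HQ B1 B2 S sA pD sHS sHU sHQ uS HSA HUS HQS P H.
have key (x : 'cV[R]_(nS + (nU + nQ))) : x != 0 ->
  [/\ 0 < mdot H x x, (2 * K)^-1 * mdot H x x <= mdot H x (P *m x) &
      mdot H (P *m x) (P *m x) <= L * mdot H x x].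
  rewrite -[x]vsubmxK -[dsubmx x]vsubmxK.
  set s := usubmx x; set u := usubmx (dsubmx x); set p := dsubmx (dsubmx x).
  move=> x0.
  pose y1 := invmx HS *m (A *m s + B2^T *m u).
  pose y2 := invmx HU *m (B2 *m (y1 - s) + D *m u - B1^T *m p).
  pose y3 := invmx HQ *m (B1 *m (u - y2)).
  have E1 : HS *m y1 = A *m s + B2^T *m u by rewrite mulKVmx ?spd_unitmx.
  have E2 : HU *m y2 = B2 *m (y1 - s) + D *m u - B1^T *m p.
    by rewrite mulKVmx ?spd_unitmx.
  have E3 : HQ *m y3 = B1 *m (u - y2) by rewrite mulKVmx ?spd_unitmx.
  have Px : P *m col_mx s (col_mx u p) = col_mx y1 (col_mx y2 y3).
    rewrite /P -mulmxA.
    rewrite -(@LhatT_mulmx R nS nU nQ HS HU HQ B1 B2 y1 y2 y3) ?spd_unitmx//.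
    congr (_ *m _); rewrite !mul_block_col mul_row_col mul_col_mx !mul0mx.
    rewrite add_col_mx add0r !addr0 E1 E2 E3; congr (col_mx _ (col_mx _ _)).
      by rewrite mulmxBr !mulNmx; apply/matrixP => i j; rewrite !mxE; ring.
    by rewrite mulmxBr addrC subrK.
  rewrite Px !mdot_Hdiag.
  have lo := block_inner_ge sA pD sHS sHU sHQ uS a0 a1 b0 b1 HSA HUS E1 E2 E3.
  have no := block_norm_le sA pD sHS sHU uS a0 a1 b0 b1 CQ0 HSA HUS HQS E1.
  have up :=
    block_image_le sA pD sHS sHU sHQ uS a0 a1 b0 b1 cQ0 HSA HUS HQS E1 E2 E3.
  split=> //.
    have s0 := proj2 (spd_psd sHS) s; have u0 := proj2 (spd_psd sHU) u.
    have p0 := proj2 (spd_psd sHQ) p.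
    rewrite ltNge; apply: contra x0 => le0.
    have -> : s = 0 by apply: (spd_eq0 sHS); clear -le0 s0 u0 p0; lra.
    have -> : u = 0 by apply: (spd_eq0 sHU); clear -le0 s0 u0 p0; lra.
    have -> : p = 0 by apply: (spd_eq0 sHQ); clear -le0 s0 u0 p0; lra.
    by rewrite !col_mx0.
  rewrite invfM -mulrA (le_trans _ lo)// ler_pM2l ?invr_gt0//.
  by rewrite mulrC ler_pdivrMr// mulrC.
split.
  apply: le_ereal_inf_tmp => _ [x /= x0 <-]; have [Hx lo _] := key x x0.
  by rewrite lee_fin ler_pdivlMr.
apply: ge_ereal_sup => _ [x /= x0 <-]; have [Hx _ up] := key x x0.
rewrite lee_fin /mnorm ler_pdivrMr ?sqrtr_gt0// -sqrtrM ?(ltW L0)//.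
exact: (ler_wsqrtr up).
Qed.

(** * Iterated integrals *)

Section IteratedIntegral.

Context {R : realType}.
Notation mu := (@lebesgue_measure R).

(* Measurability of [f : X -> R^n -> \bar R], expressed along all coordinatewise
   measurable curves, which avoids choosing a sigma-algebra on row vectors. *)
Definition curve_measurable d (X : measurableType d) n
    (f : X -> 'rV[R]_n -> \bar R) :=
  forall d' (Y : measurableType d') (g : Y -> X) (h : Y -> 'rV[R]_n),
    measurable_fun setT g ->
    (forall i, measurable_fun setT (fun y => h y 0 i : measurableTypeR R)) ->
    measurable_fun setT (fun y => f (g y) (h y)).

(** The splitting of coordinates inside [iint], with its type stated as ['rV_n.+1]. *)
Definition cons_row n (t : R) (y : 'rV[R]_n) : 'rV[R]_n.+1 := row_mx t%:M y.

Lemma cons_row0 n t (y : 'rV[R]_n) : cons_row t y 0 ord0 = t.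
Proof.
have -> : ord0 = lshift n (0 : 'I_1) :> 'I_(1 + n) by exact: val_inj.
by rewrite [LHS]row_mxEl mxE eqxx mulr1n.
Qed.

Lemma cons_rowS n t (y : 'rV[R]_n) j : cons_row t y 0 (lift ord0 j) = y 0 j.
Proof.
have -> : lift ord0 j = rshift 1 j :> 'I_(1 + n) by exact: val_inj.
by rewrite [LHS]row_mxEr.
Qed.

Lemma cons_row_measurable d (Y : measurableType d) n
    (t : Y -> measurableTypeR R) (h : Y -> 'rV[R]_n) :
  measurable_fun setT t ->
  (forall i, measurable_fun setT (fun y => h y 0 i : measurableTypeR R)) ->
  forall i, measurable_fun setT
    (fun y => cons_row (t y) (h y) 0 i : measurableTypeR R).
Proof.
move=> mt mh i; case: (unliftP ord0 i) => [j|] -> /=.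
  by under eq_fun do rewrite cons_rowS; apply: mh.
by under eq_fun do rewrite cons_row0.
Qed.

(** Moving the first coordinate into the parameter is what makes the induction on the dimension
    possible. *)
Lemma curve_measurable_section d (X : measurableType d) n
    (f : X -> 'rV[R]_n.+1 -> \bar R) : curve_measurable f ->
  curve_measurable (fun (p : X * measurableTypeR R) (y : 'rV[R]_n) =>
    f p.1 (cons_row p.2 y)).
Proof.
move=> mf d' Y g h mg mh; apply: mf.
  exact: (measurableT_comp measurable_fst mg).
apply: cons_row_measurable => //.
exact: (measurableT_comp measurable_snd mg).
Qed.

Lemma iint_measurable n d (X : measurableType d) (f : X -> 'rV[R]_n -> \bar R) :
  curve_measurable f -> measurable_fun setT (fun x => iint (f x)).
Proof.
elim: n d X f => [|n IH] d X f mf /=.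
  by apply: (mf _ X id (fun=> 0)) => // i; exact: measurable_cst.
have := IH _ _ _ (curve_measurable_section mf); set F := fun _ => _ => mF.
(* [F] need be neither nonnegative nor integrable, so Tonelli is applied to its positive and
   negative parts. *)
rewrite [X in measurable_fun _ X](_ : _ =
    (fun x => \int[mu]_t F^\+ (x, t) - \int[mu]_t F^\- (x, t))%E).
  apply: emeasurable_funB; apply: measurable_fun_fubini_tonelli_F => //.
    exact: measurable_funepos.
  exact: measurable_funeneg.
apply/funext => x; rewrite [LHS]integralE.
by congr (_ - _)%E; apply: eq_integral => t _; rewrite ?funeposE ?funenegE.
Qed.

Definition curve_measurable1 n (f : 'rV[R]_n -> R) :=
  forall d (Y : measurableType d) (h : Y -> 'rV[R]_n),
    (forall i, measurable_fun setT (fun y => h y 0 i : measurableTypeR R)) ->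
    measurable_fun setT (fun y => f (h y) : measurableTypeR R).

(** A class stable under freezing the first coordinate, in which finiteness and linearity of [iint]
    follow by induction: [c] bounds the values and [K] the support. *)
Definition box_bounded n (K c : R) (f : 'rV[R]_n -> R) :=
  [/\ curve_measurable1 f, forall x, `|f x| <= c &
      forall x i, f x != 0 -> `|x 0 i| <= K].

(** The section vanishes for [t] outside [[- K, K]]; keeping the indicator in the bound supplies an
    integrable majorant in [t]. *)
Lemma box_bounded_section n K c t (f : 'rV[R]_n.+1 -> R) : box_bounded K c f ->
  box_bounded K (c * \1_(`[- K, K]%classic) t)
    (fun y : 'rV[R]_n => f (cons_row t y)).
Proof.
move=> [mf fc fK]; split.
- move=> d Y h mh; apply: mf; apply: cons_row_measurable => //.
- move=> y; rewrite indicE; case: (boolP (_ \in _)) => [_|tK].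
    by rewrite mulr1.
  rewrite mulr0 normr_le0; apply: contraNT tK => /(fK _ ord0).
  by rewrite cons_row0 inE /= in_itv /= ler_norml.
- by move=> y i /(fK _ (lift ord0 i)); rewrite cons_rowS.
Qed.

Lemma box_integrable (K a : R) :
  mu.-integrable setT (fun t => (a * \1_(`[- K, K]%classic) t)%:E).
Proof.
under eq_fun do rewrite EFinM.
by apply: integrableZl => //; exact: integrable_indic_itv.
Qed.

Lemma box_integral (K a : R) : 0 <= K ->
  (\int[mu]_t (a * \1_(`[- K, K]%classic) t)%:E = (a * (2 * K))%:E)%E.
Proof.
move=> K0; under eq_integral do rewrite EFinM.
rewrite integralZl//; last exact: integrable_indic_itv.
rewrite integral_indic//= setIT lebesgue_measure_itv/= lte_fin -EFinD.
case: ltP => KK; first by rewrite -EFinM; congr (_ * _)%:E; ring.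
by rewrite (_ : K = 0) ?mulr0 ?mule0//; lra.
Qed.

Lemma iint_section_integrable n (f : 'rV[R]_n.+1 -> R) K c C :
  box_bounded K c f ->
  (forall t, exists2 r,
    iint (fun y : 'rV[R]_n => (f (cons_row t y))%:E) = r%:E &
    `|r| <= C * \1_(`[- K, K]%classic) t) ->
  mu.-integrable setT
    (fun t => iint (fun y : 'rV[R]_n => (f (cons_row t y))%:E)).
Proof.
move=> [mf _ _] fC; apply: (le_integrable _ _ _ (box_integrable K C)) => //.
  apply: (iint_measurable (X := measurableTypeR R)
    (f := fun t y => (f (cons_row t y))%:E)).
  move=> d' Y g h mg mh; apply/measurable_EFinP.
  by apply: mf; apply: cons_row_measurable.
move=> t _; have [r -> rC] := fC t.
by rewrite /= lee_fin (le_trans rC)// ler_norm.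
Qed.

Lemma iint_box_bounded n (f : 'rV[R]_n -> R) K c : 0 <= K -> box_bounded K c f ->
  exists2 r, iint (fun x => (f x)%:E) = r%:E & `|r| <= c * (2 * K) ^+ n.
Proof.
move=> K0; elim: n c f => [|n IH] c f bf /=.
  by exists (f 0) => //; rewrite expr0 mulr1; case: bf.
have sec t : exists2 r,
    iint (fun y : 'rV[R]_n => (f (cons_row t y))%:E) = r%:E &
    `|r| <= c * (2 * K) ^+ n * \1_(`[- K, K]%classic) t.
  have [r rE rc] := IH _ _ (box_bounded_section t bf); exists r => //.
  by rewrite mulrAC.
have iF := iint_section_integrable bf sec.
have fF := integrable_fin_num measurableT iF.
exists (fine (\int[mu]_t
    iint (fun y : 'rV[R]_n => (f (cons_row t y))%:E))).
  by rewrite fineK.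
rewrite -lee_fin -abse_EFin fineK// exprSr (mulrA c) -(box_integral _ K0).
apply: le_trans (le_abse_integral _ _ _) _ => //; first exact: measurable_int iF.
apply: ge0_le_integral => //.
- by apply: measurableT_comp => //; exact: measurable_int iF.
- exact: measurable_int (box_integrable _ _).
- by move=> t _; have [r -> rC] := sec t; rewrite abse_EFin lee_fin.
Qed.

Lemma iintD n (f g : 'rV[R]_n -> R) K c a : 0 <= K ->
  box_bounded K c f -> box_bounded K c g ->
  iint (fun x => (f x + a * g x)%:E) =
  (iint (fun x => (f x)%:E) + a%:E * iint (fun x => (g x)%:E))%E.
Proof.
move=> K0; elim: n c f g => [|n IH] c f g bf bg /=; first by rewrite EFinD EFinM.
have sec h t : box_bounded K c h -> exists2 r,
    iint (fun y : 'rV[R]_n => (h (cons_row t y))%:E) = r%:E &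
    `|r| <= c * (2 * K) ^+ n * \1_(`[- K, K]%classic) t.
  move=> bh; have [r rE rc] := iint_box_bounded K0 (box_bounded_section t bh).
  by exists r => //; rewrite mulrAC.
have iF := iint_section_integrable bf (sec f ^~ bf).
have iG := iint_section_integrable bg (sec g ^~ bg).
rewrite -integralZl// -integralD//; last exact: integrableZl.
apply: eq_integral => t _.
exact: IH (box_bounded_section t bf) (box_bounded_section t bg).
Qed.

Lemma iint_ge0 n (f : 'rV[R]_n -> \bar R) :
  (forall x, (0 <= f x)%E) -> (0 <= iint f)%E.
Proof.
elim: n f => [|n IH] f f0 //=.
by apply: integral_ge0 => t _; exact: IH.
Qed.

Lemma iint_gt0 n (f : 'rV[R]_n -> R) (K c : R) (x0 : 'rV[R]_n) (e h : R) :
  0 <= K -> box_bounded K c f ->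
  (forall x, 0 <= f x) -> 0 < e -> 0 < h ->
  (forall x : 'rV[R]_n, (forall i, `|x 0 i - x0 0 i| <= h) -> e <= f x) ->
  (0 < iint (fun x => (f x)%:E))%E.
Proof.
move=> K0 bf f0 e0 h0 ef.
(* The induction is run on an explicit lower bound, the integral of [e] over the cube of half-side
   [h] about [x0]. *)
suff : ((e * (2 * h) ^+ n)%:E <= iint (fun x => (f x)%:E))%E.
  by apply: lt_le_trans; rewrite lte_fin mulr_gt0 ?exprn_gt0 ?mulr_gt0.
elim: n c f x0 bf f0 ef => [|n IH] c f x0 bf f0 ef /=.
  by rewrite expr0 mulr1 lee_fin ef// => -[].
have sec t : exists2 r,
    iint (fun y : 'rV[R]_n => (f (cons_row t y))%:E) = r%:E &
    `|r| <= c * (2 * K) ^+ n * \1_(`[- K, K]%classic) t.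
  have [r rE rc] := iint_box_bounded K0 (box_bounded_section t bf).
  by exists r => //; rewrite mulrAC.
have iF := iint_section_integrable bf sec.
pose t0 := x0 0 0; pose D := `[t0 - h, t0 + h]%classic.
have mD : measurable D by exact: measurable_itv.
have -> : (e * (2 * h) ^+ n.+1)%:E = (\int[mu]_(t in D) (e * (2 * h) ^+ n)%:E)%E.
  rewrite integral_cst//= lebesgue_measure_itv/= lte_fin ifT; last by lra.
  by rewrite -EFinD -EFinM exprSr mulrA; congr (_ * _)%:E; ring.
apply: (@le_trans _ _ (\int[mu]_(t in D)
    iint (fun y : 'rV[R]_n => (f (cons_row t y))%:E))%E); last first.
  apply: ge0_subset_integral => //; first exact: measurable_int iF.
  by move=> t _; apply: iint_ge0 => y; rewrite lee_fin.
apply: ge0_le_integral => //.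
- by move=> t _; rewrite lee_fin mulr_ge0 ?exprn_ge0 ?mulr_ge0// ltW.
- by apply: measurable_funTS; exact: measurable_int iF.
- move=> t; rewrite /D/= in_itv/= => tD.
    apply: (IH _ _ (\row_i x0 0 (lift ord0 i))) => //.
      exact: (box_bounded_section t bf).
    move=> y yx0; apply: ef => i; case: (unliftP ord0 i) => [j|] ->.
      by rewrite cons_rowS; have := yx0 j; rewrite mxE.
    by rewrite cons_row0 ler_distl.
Qed.

End IteratedIntegral.

(** * Polynomial maps *)

Section PolynomialMaps.

Context {R : realType} {d : nat}.
Implicit Types f g : 'rV[R]_d -> R.

(** Polynomials without a degree bound, given by generators so that continuity, measurability,
    boundedness and differentiability are inductions on four cases. *)
Inductive polynomial_map : ('rV[R]_d -> R) -> Prop :=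
| polynomial_map_cst c : polynomial_map (fun=> c)
| polynomial_map_coord i : polynomial_map (fun x => x 0 i)
| polynomial_mapD f g : polynomial_map f -> polynomial_map g ->
    polynomial_map (fun x => f x + g x)
| polynomial_mapM f g : polynomial_map f -> polynomial_map g ->
    polynomial_map (fun x => f x * g x).

Lemma polynomial_mapN f : polynomial_map f -> polynomial_map (fun x => - f x).
Proof.
move=> pf; under eq_fun do rewrite -mulN1r.
by apply: polynomial_mapM => //; apply: polynomial_map_cst.
Qed.

Lemma polynomial_map_sum (I : Type) (r : seq I) (P : pred I)
    (F : I -> 'rV[R]_d -> R) : (forall i, P i -> polynomial_map (F i)) ->
  polynomial_map (fun x => \sum_(i <- r | P i) F i x).
Proof.
move=> pF; elim: r => [|i r IH].
  by under eq_fun do rewrite big_nil; apply: polynomial_map_cst.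
under eq_fun do rewrite big_cons; case: (boolP (P i)) => // Pi.
by apply: polynomial_mapD => //; apply: pF.
Qed.

Lemma polynomial_map_prod (I : Type) (r : seq I) (P : pred I)
    (F : I -> 'rV[R]_d -> R) : (forall i, P i -> polynomial_map (F i)) ->
  polynomial_map (fun x => \prod_(i <- r | P i) F i x).
Proof.
move=> pF; elim: r => [|i r IH].
  by under eq_fun do rewrite big_nil; apply: polynomial_map_cst.
under eq_fun do rewrite big_cons; case: (boolP (P i)) => // Pi.
by apply: polynomial_mapM => //; apply: pF.
Qed.

Lemma polyfun_polynomial_map k f : polyfun k f -> polynomial_map f.
Proof.
move=> [p [_ fp]]; have -> : f = fun x => meval (fun i => x 0 i) p by apply/funext.
under eq_fun do rewrite mevalE; apply: polynomial_map_sum => m _.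
apply: polynomial_mapM; first exact: polynomial_map_cst.
apply: polynomial_map_prod => i _; elim: (m i) => [|n IH].
  by under eq_fun do rewrite expr0; apply: polynomial_map_cst.
under eq_fun do rewrite exprS.
by apply: polynomial_mapM => //; apply: polynomial_map_coord.
Qed.

Lemma polynomial_map_continuous f : polynomial_map f -> continuous f.
Proof.
elim=> {f} [c|i|f g _ cf _ cg|f g _ cf _ cg] x.
- exact: cst_continuous.
- exact: coord_continuous.
- exact: cvgD (cf x) (cg x).
- exact: cvgM (cf x) (cg x).
Qed.

Lemma polynomial_map_measurable f : polynomial_map f -> curve_measurable1 f.
Proof.
elim=> {f} [c|i|f g _ mf _ mg|f g _ mf _ mg] d' Y h mh.
- exact: measurable_cst.
- exact: mh.
- by apply: measurable_funD; [exact: mf|exact: mg].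
- by apply: measurable_funM; [exact: mf|exact: mg].
Qed.

Lemma polynomial_map_bounded f (K : R) : polynomial_map f ->
  exists2 c, 0 <= c & forall x : 'rV[R]_d, (forall i, `|x 0 i| <= K) -> `|f x| <= c.
Proof.
elim=> {f} [c|i|f g _ [a a0 af] _ [b b0 bg]|f g _ [a a0 af] _ [b b0 bg]].
- by exists `|c|.
- by exists `|K| => // x xK; exact: le_trans (xK i) (ler_norm _).
- exists (a + b) => [|x xK]; first exact: addr_ge0.
  by rewrite (le_trans (ler_normD _ _))// lerD ?af ?bg.
- exists (a * b) => [|x xK]; first exact: mulr_ge0.
  by rewrite normrM ler_pM ?af ?bg.
Qed.

Lemma polynomial_map_line f (x v : 'rV[R]_d) : polynomial_map f ->
  exists p : {poly R}, forall s : R, f (x + s *: v) = p.[s].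
Proof.
elim=> {f} [c|i|f g _ [p fp] _ [q gq]|f g _ [p fp] _ [q gq]].
- by exists c%:P => s; rewrite hornerC.
- exists ((x 0 i)%:P + (v 0 i) *: 'X) => s.
  by rewrite !mxE hornerD hornerC hornerZ hornerX mulrC.
- by exists (p + q) => s; rewrite fp gq hornerD.
- by exists (p * q) => s; rewrite fp gq hornerM.
Qed.

Lemma polynomial_map_derive f (v : 'rV[R]_d) : polynomial_map f ->
  exists2 g, polynomial_map g & forall x, is_derive x v f (g x).
Proof.
elim=> {f} [c|i|f g pf [f' pf' ff'] pg [g' pg' gg']|
  f g pf [f' pf' ff'] pg [g' pg' gg']].
- exists (fun=> 0); first exact: polynomial_map_cst.
  by move=> x; apply: is_derive_cst.
- exists (fun=> v 0 i); first exact: polynomial_map_cst.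
  move=> x; have cv : (fun h : R => h^-1 *: ((h *: v + x) 0 i - x 0 i)) @ 0^'
      --> (v 0 i : R^o).
    apply: cvg_near_cst; near=> h.
    rewrite !mxE addrK /GRing.scale/= mulKf//; near: h; exact: nbhs_dnbhs_neq.
  apply: DeriveDef; [exact: cvgP cv|exact: cvg_lim cv].
- exists (fun x => f' x + g' x); first exact: polynomial_mapD.
  by move=> x; apply: is_deriveD.
- exists (fun x => f x * g' x + g x * f' x).
    by apply: polynomial_mapD; apply: polynomial_mapM.
  by move=> x; apply: is_deriveM.
Unshelve. all: by end_near.
Qed.

Lemma polynomial_map_partial i f : polynomial_map f -> polynomial_map (partial i f).
Proof.
move=> /(polynomial_map_derive (delta_mx 0 i))[g pg fg].
rewrite (_ : partial i f = g)//.
by apply/funext => x; rewrite /partial (@derive_val _ _ _ _ _ _ _ (fg x)).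
Qed.

(** On the line through [x0] and [x], [f] is a univariate polynomial that vanishes for all small
    parameters, hence identically; the parameter 1 gives [f x]. *)
Lemma polynomial_map_eq0 f (x0 : 'rV[R]_d) : polynomial_map f ->
  (\forall x \near x0, f x = 0) -> forall x, f x = 0.
Proof.
move=> pf near0 x.
have [p fp] := polynomial_map_line x0 (x - x0) pf.
suff p0 : p = 0.
  by have := fp 1; rewrite scale1r addrC subrK p0 horner0.
have : \forall s \near (0 : R), f (x0 + s *: (x - x0)) = 0.
  have cv : (fun s : R => x0 + s *: (x - x0)) @ 0 --> x0.
    rewrite -[X in _ --> X]addr0; apply: cvgD; first exact: cvg_cst.
    rewrite -[X in _ --> X](scale0r (x - x0)); apply: cvgZl; exact: cvg_id.
  exact: (cv _ near0).
move=> /nbhs_ballP[e /= e0 he].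
(* Distinct points of the open interval []0, e[]; [size p] of them exceed the degree of a nonzero
   [p]. *)
pose r (k : nat) : R := e / (k.+2)%:R.
apply: (@roots_geq_poly_eq0 _ p [seq r k | k <- iota 0 (size p)]).
- apply/allP => _ /mapP[k _ ->]; rewrite /root -fp; apply/eqP/he.
  rewrite /ball/= sub0r normrN gtr0_norm ?divr_gt0//.
  by rewrite ltr_pdivrMr// ltr_pMr// ltr1n.
- rewrite map_inj_uniq ?iota_uniq// => k l.
  move=> /(mulfI (lt0r_neq0 e0)) /invr_inj /eqP.
  by rewrite eqr_nat => /eqP[].
- by rewrite size_map size_iota.
Qed.

End PolynomialMaps.

(** * Integrals of polynomials over cells *)

Section PolynomialCells.

Context {R : realType} {d : nat}.
Implicit Types f g : 'rV[R]_d -> R.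

(** What is retained of a simplex: a bounded set cut out by polynomial inequalities, with a point
    where all of them are strict. For simplices [lam] will be the barycentric coordinates. *)
Record polynomial_cell (D : set 'rV[R]_d) (N : nat)
    (lam : 'I_N -> 'rV[R]_d -> R) := PolynomialCell {
  cell_polynomial : forall i, polynomial_map (lam i);
  cellE : D = [set x | forall i, 0 <= lam i x];
  cell_interior : exists x, forall i, 0 < lam i x;
  cell_bounded : exists2 K : R, 0 <= K & forall x i, D x -> `|x 0 i| <= K
}.

Context {D : set 'rV[R]_d} {N : nat} {lam : 'I_N -> 'rV[R]_d -> R}.
Hypothesis cD : polynomial_cell D lam.

(** Every larger [c'] is allowed as well, so that two functions can be given a common bound. *)
Lemma cell_box_bounded f : polynomial_map f ->
  exists K, 0 <= K /\
    exists2 c, 0 <= c & forall c', c <= c' -> box_bounded K c' (f \_ D).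
Proof.
move=> pf; have [K K0 DK] := cell_bounded cD; exists K; split=> //.
have [c c0 fc] := polynomial_map_bounded K pf; exists c => // c' cc'; split.
- move=> d' Y h mh; rewrite /patch.
  apply: measurable_fun_if => //.
  (* Membership in [D] is a finite conjunction of polynomial inequalities, hence measurable along
     [h]. *)
  + rewrite (_ : (fun y => h y \in D) =
      (fun y => all (fun i => 0 <= lam i (h y)) (enum 'I_N))).
      elim: (enum _) => [|i r IH] /=; first exact: measurable_cst.
      apply: measurable_and => //; apply: measurable_fun_ler => //.
      exact: (polynomial_map_measurable (cell_polynomial cD i)).
    apply/funext => y; apply/idP/allP => [|h0].
      by rewrite inE (cellE cD) => h0 i _; exact: h0.
    by rewrite inE (cellE cD) => i; apply: h0; rewrite mem_enum.
  + by apply: measurable_funTS; apply: (polynomial_map_measurable pf).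
- move=> x; rewrite /patch; case: ifPn => [|_]; last by rewrite normr0 (le_trans c0).
  by rewrite inE => Dx; apply: le_trans cc'; apply: fc => i; exact: DK.
- move=> x i; rewrite /patch; case: ifPn => [|_]; last by rewrite eqxx.
  by rewrite inE => Dx _; exact: DK.
Qed.

Lemma cell_box_bounded2 f g : polynomial_map f -> polynomial_map g ->
  exists K c, [/\ 0 <= K, box_bounded K c (f \_ D) & box_bounded K c (g \_ D)].
Proof.
move=> /cell_box_bounded[K [K0 [a a0 fa]]] /cell_box_bounded[L [L0 [b b0 gb]]].
have wid K' L' c h : K' <= L' -> @box_bounded R d K' c h -> box_bounded L' c h.
  by move=> KL [m1 m2 m3]; split=> // x i hx; exact: le_trans (m3 x i hx) KL.
exists (K + L), (a + b); split; first exact: addr_ge0.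
- by apply: wid (fa _ _); rewrite ?lerDl.
- by apply: wid (gb _ _); rewrite ?lerDr.
Qed.

Lemma cell_iint_fin_num f : polynomial_map f ->
  iint (fun x => ((f \_ D) x)%:E) \is a fin_num.
Proof.
move=> /cell_box_bounded[K [K0 [c c0 /(_ c (lexx c)) bf]]].
by have [r ->] := iint_box_bounded K0 bf.
Qed.

Lemma vol_intD f g a : polynomial_map f -> polynomial_map g ->
  vol_int D (fun x => f x + a * g x) = vol_int D f + a * vol_int D g.
Proof.
move=> pf pg; rewrite /vol_int.
have [K [c [K0 bf bg]]] := cell_box_bounded2 pf pg.
rewrite (_ : (fun x => _) = (fun x => ((f \_ D) x + a * (g \_ D) x)%:E)).
  rewrite (iintD a K0 bf bg) fineD ?fineM// ?fin_numM//; exact: cell_iint_fin_num.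
apply/funext => x; congr _%:E; rewrite /patch; case: ifP => // _.
by rewrite mulr0 addr0.
Qed.

(** Additivity at zero gives [I = I + I] for this integral. *)
Lemma vol_int_cst0 : vol_int D (fun=> 0) = 0.
Proof.
have p0 : polynomial_map (fun _ : 'rV[R]_d => 0) by apply: polynomial_map_cst.
have := vol_intD 1 p0 p0; under eq_fun do rewrite mulr0 addr0.
by move=> /eqP; rewrite mul1r -subr_eq0 opprD addNKr oppr_eq0 => /eqP.
Qed.

Lemma vol_int_sum n (a : 'I_n -> R) (f : 'I_n -> 'rV[R]_d -> R) :
  (forall i, polynomial_map (f i)) ->
  vol_int D (fun x => \sum_i a i * f i x) = \sum_i a i * vol_int D (f i).
Proof.
move=> pf; elim: (index_enum 'I_n) => [|i r IH].
  by under eq_fun do rewrite big_nil; rewrite big_nil vol_int_cst0.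
under eq_fun do rewrite big_cons addrC.
rewrite vol_intD// ?IH ?big_cons 1?addrC//.
apply: polynomial_map_sum => j _.
by apply: polynomial_mapM => //; apply: polynomial_map_cst.
Qed.

Lemma vol_int_ge0 f : (forall x, 0 <= f x) -> 0 <= vol_int D f.
Proof.
move=> f0; apply: fine_ge0; apply: iint_ge0 => x.
by rewrite lee_fin /patch; case: ifP.
Qed.

Lemma cell_interior_near x : (forall i, 0 < lam i x) ->
  \forall y \near x, forall i, 0 < lam i y.
Proof.
move=> lx; have near_i i : \forall y \near x, 0 < lam i y.
  have cv : lam i y @[y --> x] --> lam i x.
    exact: (polynomial_map_continuous (cell_polynomial cD i)).
  exact: (cvgr_gt _ cv _ (lx i)).
exact: (@filter_forall _ _ _ _ _ near_i).
Qed.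

(** Were [f x] positive at an interior point, [f] would exceed [f x / 2] on a cube inside [D], and
    the integral would be positive. *)
Lemma vol_int_eq0 f : polynomial_map f -> (forall x, 0 <= f x) ->
  vol_int D f = 0 -> forall x, (forall i, 0 < lam i x) -> f x = 0.
Proof.
move=> pf f0 If x lx; apply/eqP; rewrite eq_le f0 andbT leNgt; apply/negP => fx.
have [K [K0 [c c0 /(_ c (lexx c)) bf]]] := cell_box_bounded pf.
have fx2 : 0 < f x / 2 by lra.
have /nbhs_ballP[e /= e0 he] :
    \forall y \near x, f x / 2 < f y /\ forall i, 0 < lam i y.
  have fy : \forall y \near x, f x / 2 < f y.
    have cv : f y @[y --> x] --> f x by exact: (polynomial_map_continuous pf).
    by apply: (cvgr_gt _ cv); lra.
  have ly := cell_interior_near lx.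
  by near=> y; split; near: y.
(* The closed cube of half-side [e / 2] lies in the open sup-norm ball of radius [e]. *)
have e2 : 0 < e / 2 by lra.
have : (0 < iint (fun x => ((f \_ D) x)%:E))%E.
  apply: (iint_gt0 (x0 := x) K0 bf _ fx2 e2) => [y|y xy].
    by rewrite /patch; case: ifP.
  have [fy ly] : f x / 2 < f y /\ forall i, 0 < lam i y.
    apply: he; split=> // i j; rewrite (ord1 i) /ball/= distrC.
    by apply: (le_lt_trans (xy j)); lra.
  by rewrite /patch ifT ?(ltW fy)// inE (cellE cD) => i; exact: ltW.
have := cell_iint_fin_num pf; rewrite /vol_int in If.
by move=> /fineK <-; rewrite If ltxx.
Unshelve. all: by end_near.
Qed.

Lemma polynomial_map_cell_eq0 f : polynomial_map f ->
  (forall x, (forall i, 0 < lam i x) -> f x = 0) -> forall x, f x = 0.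
Proof.
move=> pf f0; have [x0 lx0] := cell_interior cD.
apply: (polynomial_map_eq0 (x0 := x0) pf).
by apply: filterS (cell_interior_near lx0) => y; exact: f0.
Qed.

End PolynomialCells.

(** [mdot G x x] is the integral of the sum of squares of the components [g x T l] of the
    combination with coefficients [x]. If it is zero, these polynomials vanish inside each cell and
    therefore on the whole space. [L] indexes components, such as matrix entries. *)
Lemma gram_polynomial (R : realType) (d n M : nat) (L : finType)
    (D : 'I_M -> set 'rV[R]_d) (N : 'I_M -> nat)
    (lam : forall T, 'I_(N T) -> 'rV[R]_d -> R)
    (f : 'I_n -> 'I_M -> L -> 'rV[R]_d -> R) (G : 'M[R]_n) :
  (forall T, polynomial_cell (D T) (@lam T)) ->
  (forall i T l, polynomial_map (f i T l)) ->
  (forall i j, G i j =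
    \sum_T vol_int (D T) (fun x => \sum_l f j T l x * f i T l x)) ->
  psd G /\ forall x : 'cV[R]_n, mdot G x x = 0 ->
    forall T l y, \sum_i x i 0 * f i T l y = 0.
Proof.
move=> cD pf GE.
have pff i j T : polynomial_map (fun y => \sum_l f j T l y * f i T l y).
  by apply: polynomial_map_sum => l _; apply: polynomial_mapM.
pose g (x : 'cV[R]_n) T l y : R := \sum_i x i 0 * f i T l y.
have pg x T l : polynomial_map (g x T l).
  apply: polynomial_map_sum => i _; apply: polynomial_mapM => //.
  exact: polynomial_map_cst.
have xGx (x : 'cV[R]_n) :
    mdot G x x = \sum_T vol_int (D T) (fun y => \sum_l g x T l y * g x T l y).
  rewrite mdotE ipE; under eq_bigr => i _.
    rewrite mxE mulrC; under eq_bigr do rewrite GE.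
    rewrite big_distrr /=; under eq_bigr do rewrite mulrC mulr_suml mulr_suml.
    rewrite exchange_big /=; over.
  rewrite exchange_big /=; apply: eq_bigr => T _.
  rewrite (_ : (fun y => _) = (fun y => \sum_i x i 0 *
      (\sum_j x j 0 * (\sum_l f j T l y * f i T l y)))).
    rewrite (vol_int_sum (cD T)) => [|i].
      apply: eq_bigr => i _; rewrite (vol_int_sum (cD T))//.
      by rewrite mulr_sumr; apply: eq_bigr => j _; ring.
    apply: polynomial_map_sum => j _; apply: polynomial_mapM => //.
    exact: polynomial_map_cst.
  apply/funext => y; transitivity
      (\sum_l \sum_i \sum_j x i 0 * (x j 0 * (f j T l y * f i T l y))).
    apply: eq_bigr => l _; rewrite /g mulr_suml; apply: eq_bigr => i _.
    by rewrite mulr_sumr; apply: eq_bigr => j _; ring.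
  rewrite exchange_big; apply: eq_bigr => i _ /=.
  rewrite exchange_big mulr_sumr; apply: eq_bigr => j _ /=.
  by rewrite !mulr_sumr.
have sq0 (x : 'cV[R]_n) T y : 0 <= \sum_l g x T l y * g x T l y.
  by apply: sumr_ge0 => l _; rewrite -expr2 sqr_ge0.
split=> [|x].
  split=> [|x]; last by rewrite xGx; apply: sumr_ge0 => T _; exact: vol_int_ge0.
  apply/matrixP => i j; rewrite mxE !GE; apply: eq_bigr => T _.
  by congr vol_int; apply/funext => y; apply: eq_bigr => l _; rewrite mulrC.
rewrite xGx => /eqP; rewrite psumr_eq0 => [/allP /= xx0|T _]; last first.
  exact: vol_int_ge0.
move=> T l; apply: (polynomial_map_cell_eq0 (cD T) (pg x T l)) => y ly.
have /eqP IT := xx0 T (mem_index_enum T).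
have pgg : polynomial_map (fun y => \sum_l g x T l y * g x T l y).
  by apply: polynomial_map_sum => l' _; apply: polynomial_mapM.
have /eqP := vol_int_eq0 (cD T) pgg (sq0 x T) IT ly.
rewrite psumr_eq0 => [/allP /(_ l (mem_index_enum l))|l' _].
  by rewrite mulf_eq0 orbb => /eqP.
by rewrite -expr2 sqr_ge0.
Qed.

(** * Finite element matrices *)

Section Simplices.

Context {R : realType} {d : nat} {Omega : set 'rV[R]_d} {Th : mesh Omega}.
Variable T : 'I_(nelt Th).
Local Notation node := (@node _ _ _ Th).

Let e (j : 'I_d.+1) : 'I_(nnode Th) :=
  enum_val (cast_ord (esym (elt_card T)) j).

Let e_inj : injective e.
Proof. by move=> i j /enum_val_inj /cast_ord_inj. Qed.

Let e_elt j : e j \in elt T. Proof. exact: enum_valP. Qed.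

(** Weights on the vertices of [T], extended by zero to all nodes; the sum has at most one term
    since [e] is injective. *)
Let extend (v : 'I_d.+1 -> R) (i : 'I_(nnode Th)) : R := \sum_(j | e j == i) v j.

Let extend_e v j : extend v (e j) = v j.
Proof.
rewrite /extend (eq_bigl (pred1 j)) ?big_pred1_eq// => k.
by rewrite (inj_eq e_inj).
Qed.

Let extend_out v i : i \notin elt T -> extend v i = 0.
Proof.
move=> iT; rewrite /extend big_pred0// => j.
by apply: contraNF iT => /eqP <-.
Qed.

Let sum_extend v : \sum_i extend v i = \sum_j v j.
Proof. by rewrite [RHS](partition_big e predT). Qed.

Let scale_extend v : \sum_i extend v i *: node i = \sum_j v j *: node (e j).
Proof.
rewrite [RHS](partition_big e predT)//=; apply: eq_bigr => i _.
by rewrite scaler_suml; apply: eq_bigr => j /eqP <-.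
Qed.

(** The rows are the vertices with a leading 1, so that a kernel vector is an affine relation
    between the vertices. *)
Let W : 'M[R]_d.+1 := \matrix_j cons_row 1 (node (e j)).

Let mulW (v : 'rV[R]_d.+1) :
  v *m W = cons_row (\sum_j v 0 j) (\sum_j v 0 j *: node (e j)).
Proof.
apply/rowP => k; rewrite mxE; case: (unliftP ord0 k) => [l|] ->.
  rewrite cons_rowS summxE; apply: eq_bigr => j _.
  by rewrite mxE cons_rowS mxE.
by rewrite cons_row0; apply: eq_bigr => j _; rewrite mxE cons_row0 mulr1.
Qed.

Let W_unit : W \in unitmx.
Proof.
rewrite -row_free_unit; apply/inj_row_free => v; rewrite mulW => vW.
have v0 : \sum_j v 0 j = 0.
  have := cons_row0 (\sum_j v 0 j) (\sum_j v 0 j *: node (e j)).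
  by rewrite vW mxE.
have vn : \sum_j v 0 j *: node (e j) = 0.
  apply/rowP => l; have := cons_rowS (\sum_j v 0 j) (\sum_j v 0 j *: node (e j)) l.
  by rewrite vW !mxE => <-.
apply/rowP => j; rewrite mxE -(extend_e (fun j => v 0 j)).
apply: (elt_indep (extend_out _)); first by rewrite sum_extend.
by rewrite scale_extend.
Qed.

(** The barycentric coordinates in closed form, visibly affine in [x], whereas [bary] is defined by
    choice. *)
Let mu (x : 'rV[R]_d) : 'rV[R]_d.+1 := cons_row 1 x *m invmx W.

Let mu_cons x :
  cons_row 1 x = cons_row (\sum_j mu x 0 j) (\sum_j mu x 0 j *: node (e j)).
Proof. by rewrite -mulW /mu mulmxKV. Qed.

Let sum_mu x : \sum_j mu x 0 j = 1.
Proof. by have := cons_row0 1 x; rewrite mu_cons cons_row0. Qed.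

Let scale_mu x : \sum_j mu x 0 j *: node (e j) = x.
Proof. by apply/rowP => l; rewrite -(cons_rowS 1 x) mu_cons cons_rowS. Qed.

Let mu_polynomial j : polynomial_map (fun x => mu x 0 j).
Proof.
under eq_fun do rewrite mxE; apply: polynomial_map_sum => k _.
apply: polynomial_mapM; last exact: polynomial_map_cst.
case: (unliftP ord0 k) => [l|] ->.
  by under eq_fun do rewrite cons_rowS; exact: polynomial_map_coord.
by under eq_fun do rewrite cons_row0; exact: polynomial_map_cst.
Qed.

Let weights_mu w x : (forall i, i \notin elt T -> w i = 0) -> \sum_i w i = 1 ->
  x = \sum_i w i *: node i -> w = extend (fun j => mu x 0 j).
Proof.
move=> w0 w1 wx; apply/funext => i; apply/eqP; rewrite -subr_eq0; apply/eqP.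
apply: (@elt_indep _ _ _ Th T (fun i => w i - extend (fun j => mu x 0 j) i)).
- by move=> k kT; rewrite w0// extend_out// subrr.
- by rewrite sumrB w1 sum_extend sum_mu subrr.
- under eq_bigr do rewrite scalerBl.
  by rewrite sumrB -wx scale_extend scale_mu subrr.
Qed.

(** [mu] shows that admissible weights exist, so the default of [xget] does not occur, and affine
    independence makes them unique. *)
Let baryE x : bary T x = extend (fun j => mu x 0 j).
Proof.
rewrite /bary; set S := (X in xget _ X).
have : S (xget (fun=> 0) S).
  apply: (@xgetPex _ _ S); exists (extend (fun j => mu x 0 j)); split.
  - exact: extend_out.
  - by rewrite sum_extend sum_mu.
  - by rewrite scale_extend scale_mu.
by move=> [w0 w1 wx]; exact: weights_mu.
Qed.

Lemma bary_polynomial i : polynomial_map (fun x => bary T x i).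
Proof.
by under eq_fun do rewrite baryE; apply: polynomial_map_sum => j _.
Qed.

Let simplexE : simplex T = [set x | forall j, 0 <= mu x 0 j].
Proof.
apply/seteqP; split=> x /= => [[w [w0 wo w1 wx]] j|x0].
  by rewrite -(extend_e (fun j => mu x 0 j)) -(weights_mu wo w1 wx).
exists (extend (fun j => mu x 0 j)); split.
- by move=> i; apply: sumr_ge0 => j _.
- exact: extend_out.
- by rewrite sum_extend sum_mu.
- by rewrite scale_extend scale_mu.
Qed.

Lemma simplex_cell :
  exists lam : 'I_d.+1 -> 'rV[R]_d -> R, polynomial_cell (simplex T) lam.
Proof.
exists (fun j x => mu x 0 j); split.
- exact: mu_polynomial.
- exact: simplexE.
(* The barycentre is the interior point. *)
- pose v : 'rV[R]_d.+1 := const_mx d.+1%:R^-1.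
  exists (\sum_j v 0 j *: node (e j)) => j.
  have v1 : \sum_j v 0 j = 1.
    under eq_bigr do rewrite mxE.
    by rewrite sumr_const card_ord -[_ *+ _]mulr_natr mulVf// pnatr_eq0.
  by rewrite /mu -[X in cons_row X _]v1 -mulW mulmxK// mxE invr_gt0 ltr0n.
(* Points of the simplex have weights in [[0, 1]], so each coordinate is at most the sum of the
   absolute values of that coordinate over the vertices. *)
- exists (\sum_k \sum_j `|node (e j) 0 k|) => [|x i].
    by apply: sumr_ge0 => k _; apply: sumr_ge0.
  rewrite simplexE /= => x0; rewrite -[in X in X <= _](scale_mu x) summxE.
  apply: (le_trans (ler_norm_sum _ _ _)).
  rewrite [leRHS](bigD1 i)//= -[leLHS]addr0; apply: lerD; last first.
    by apply: sumr_ge0 => k _; apply: sumr_ge0.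
  apply: ler_sum => j _; rewrite mxE normrM ger0_norm// ler_piMl//.
  rewrite -(sum_mu x) (bigD1 j)//= lerDl; exact: sumr_ge0.
Qed.

End Simplices.

Lemma psd_congr (R : realType) m n (X : 'M[R]_m) (B : 'M[R]_(m, n)) c :
  0 <= c -> psd X -> psd (c *: (B^T *m X *m B)).
Proof.
move=> c0 [sX X0]; split=> [|x].
  by rewrite linearZ/= !trmx_mul trmxK sX mulmxA.
rewrite mdotE -scalemxAl ipZl mulr_ge0//.
by rewrite -!mulmxA ip_mulmx trmxK; exact: X0.
Qed.

(** * Stresses as trace-free polynomial fields *)

Definition polynomial_mx (R : realType) d m n (t : 'rV[R]_d -> 'M[R]_(m, n)) :=
  forall i j, polynomial_map (fun x => t x i j).

Lemma dev_polynomial (R : realType) d (t : 'rV[R]_d -> 'M[R]_d) :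
  polynomial_mx t -> polynomial_mx (fun x => dev (t x)).
Proof.
move=> pt i j.
under eq_fun do rewrite /dev !mxE -[_ *+ (_ == _)]mulr_natr.
apply: polynomial_mapD => //; apply: polynomial_mapN.
do 2 (apply: polynomial_mapM; last exact: polynomial_map_cst).
exact: polynomial_map_sum.
Qed.

Lemma tr_dev (R : realType) d (s : 'M[R]_d) : (0 < d)%N -> \tr (dev s) = 0.
Proof.
move=> d0; rewrite /dev raddfB/= mxtrace_scalar -(mulr_natr (_ / _)).
by rewrite divfK ?subrr// pnatr_eq0 -lt0n.
Qed.

Lemma dev_tr0 (R : realType) d (s : 'M[R]_d) : \tr s = 0 -> dev s = s.
Proof. by move=> s0; rewrite /dev s0 mul0r raddf0 subr0. Qed.

Lemma polynomial_mapB (R : realType) d (f g : 'rV[R]_d -> R) :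
  polynomial_map f -> polynomial_map g -> polynomial_map (fun x => f x - g x).
Proof. by move=> pf pg; apply: polynomial_mapD => //; exact: polynomial_mapN. Qed.

Lemma curlcurlB2_polynomial (R : realType) N (A : {set 'I_N})
    (lam : 'I_N -> 'rV[R]_2 -> R) r :
  (forall i, polynomial_map (lam i)) -> polynomial_mx r ->
  polynomial_mx (curlcurlB2 A lam r).
Proof.
move=> pl pr.
have pw i : polynomial_map
    (fun x => ((\prod_(i in A) lam i x) *: curl_mv2 r x) 0 i).
  under eq_fun do rewrite !mxE.
  apply: polynomial_mapM; first by apply: polynomial_map_prod.
  by apply: polynomial_mapB; apply: polynomial_map_partial.
move=> i j; have [j0|/negPf j0] := boolP (j == 0).
  by under eq_fun do rewrite mxE j0; exact: polynomial_map_partial.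
under eq_fun do rewrite mxE j0.
by apply: polynomial_mapN; exact: polynomial_map_partial.
Qed.

Lemma curl3_polynomial (R : realType) (r : 'rV[R]_3 -> 'M[R]_3) :
  polynomial_mx r -> polynomial_mx (curl3 r).
Proof.
move=> pr i j; under eq_fun do rewrite mxE.
by apply: polynomial_mapB; apply: polynomial_map_partial.
Qed.

Lemma curlcurlB3_polynomial (R : realType) N (A : {set 'I_N})
    (lam : 'I_N -> 'rV[R]_3 -> R) r :
  (forall i, polynomial_map (lam i)) -> polynomial_mx r ->
  polynomial_mx (curlcurlB3 A lam r).
Proof.
move=> pl pr; apply: curl3_polynomial => i j; under eq_fun do rewrite mxE.
apply: polynomial_map_sum => k _; apply: polynomial_mapM.
  exact: curl3_polynomial.
under eq_fun do rewrite /bubble3 summxE; apply: polynomial_map_sum => l _.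
under eq_fun do rewrite !mxE big_ord1 !mxE.
apply: polynomial_mapM; first exact: polynomial_map_prod.
by apply: polynomial_mapM; apply: polynomial_map_partial.
Qed.

Lemma curlcurlB_polynomial (R : realType) d N (A : {set 'I_N})
    (lam : 'I_N -> 'rV[R]_d -> R) r : d = 2%N \/ d = 3%N ->
  (forall i, polynomial_map (lam i)) -> polynomial_mx r ->
  polynomial_mx (curlcurlB A lam r).
Proof.
move=> d23; case: d23 lam r => ->; first exact: curlcurlB2_polynomial.
exact: curlcurlB3_polynomial.
Qed.

Lemma polymx_polynomial (R : realType) d k m n (t : 'rV[R]_d -> 'M[R]_(m, n)) :
  polymx k t -> polynomial_mx t.
Proof. by move=> pt i j; exact: polyfun_polynomial_map (pt i j). Qed.

(** The enrichment is built from polynomial barycentric coordinates by products and derivatives, and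
    is trace-free as a deviator. Since [dev] fixes trace-free matrices, [form_a] is a weighted [L^2]
    product on this space. *)
Lemma Sigmah_plus_polynomial (R : realType) d (Omega : set 'rV[R]_d)
    (Th : mesh Omega) k t : d = 2%N \/ d = 3%N -> Sigmah_plus (Th := Th) k t ->
  forall T, polynomial_mx (t T) /\ forall x, \tr (t T x) = 0.
Proof.
move=> d23 [s [_ [[sP _] [r [rW _] ->] ->]]] T.
have d0 : (0 < d)%N by case: d23 => ->.
have [ps s0] := sP T; split=> [i j|x].
  rewrite (_ : (fun x => _) = fun x => s T x i j +
      dev (curlcurlB (elt T) (fun i y => bary T y i) (r T) x) i j).
    apply: polynomial_mapD; first exact: (polymx_polynomial ps).
    apply: (dev_polynomial (t := curlcurlB _ _ _)).
    apply: curlcurlB_polynomial => // [l|]; first exact: bary_polynomial.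
    exact: polymx_polynomial (proj1 (rW T)).
  by apply/funext => x; rewrite mxE.
by rewrite -[(s + _) T x]/(s T x + _) raddfD/= s0 tr_dev// addr0.
Qed.

(** * Definiteness of the stress and pressure matrices *)

Lemma is_basis_free (R : realType) (V : lmodType R) (S : set V) n
    (phi : 'I_n -> V) (x : 'rV[R]_n) :
  is_basis S phi -> \sum_i x 0 i *: phi i = 0 -> x = 0.
Proof.
move=> [phiS basis] x0; apply/rowP => i; rewrite mxE.
have [y [yphi uniq_y]] := basis _ (phiS i).
(* [is_basis] gives uniqueness of coordinates for members of [S], so the relation is added to the
   coordinates [y] of [phi i]. *)
have yx : y = y + x.
  apply: uniq_y; under eq_bigr do rewrite mxE scalerDl.
  by rewrite big_split/= x0 addr0.
have := congr1 (fun z : 'rV_n => - y + z) yx; rewrite addNr addKr => <-.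
by rewrite mxE.
Qed.

(** The Gram matrix of the entries of the basis stresses scaled by [nu^(-1/2)]; a null vector yields
    a vanishing combination of the basis. *)
Lemma form_a_spd (R : realType) d (Omega : set 'rV[R]_d) (Th : mesh Omega)
    k nu n (phi : 'I_n -> broken Th 'M[R]_d) : d = 2%N \/ d = 3%N -> 0 < nu ->
  is_basis (Sigmah_plus (Th := Th) k) phi ->
  spd (form_mx (form_a (Th := Th) nu) phi phi).
Proof.
move=> d23 nu0 basis.
have [lam cell] := choice (simplex_cell (Th := Th)).
have pphi i := Sigmah_plus_polynomial d23 (proj1 basis i).
pose f i T (l : 'I_d * 'I_d) (x : 'rV[R]_d) : R :=
  Num.sqrt nu^-1 * phi i T x l.1 l.2.
have [pG G0] : psd (form_mx (form_a (Th := Th) nu) phi phi) /\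
    forall x : 'cV[R]_n, mdot (form_mx (form_a (Th := Th) nu) phi phi) x x = 0 ->
    forall T l y, \sum_i x i 0 * f i T l y = 0.
  apply: (gram_polynomial cell) => [i T l|i j].
    apply: polynomial_mapM; first exact: polynomial_map_cst.
    exact: (proj1 (pphi i T)).
  rewrite mxE; apply: eq_bigr => T _; congr vol_int; apply/funext => x.
  rewrite !dev_tr0 ?(proj2 (pphi _ T) x)// /frob pair_big mulr_sumr/=.
  apply: eq_bigr => l _; rewrite /f mulrACA -expr2 sqr_sqrtr// invr_ge0.
  exact: ltW.
split; first exact: (proj1 pG).
move=> x x0; rewrite lt_neqAle (proj2 pG) andbT eq_sym.
apply: contra x0 => /eqP /G0 xf; apply/eqP/trmx_inj; rewrite trmx0.
(* Equality in [broken] is equality at every point of the whole space, also outside [T]; [G0]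
   provides it. *)
apply: (is_basis_free basis); apply/funext => T; apply/funext => y.
apply/matrixP => i j.
have sq0 : Num.sqrt nu^-1 != 0 by rewrite gt_eqF// sqrtr_gt0 invr_gt0.
have -> : (\sum_l x^T 0 l *: phi l) T y = \sum_l x l 0 *: phi l T y.
  by rewrite !fct_sumE; apply: eq_bigr => l _; rewrite mxE.
apply/eqP; rewrite summxE [X in _ == X]mxE -(mulrI_eq0 _ (mulfI sq0)) mulr_sumr.
apply/eqP; rewrite -[RHS](xf T (i, j) y); apply: eq_bigr => l _.
by rewrite mxE mulrCA.
Qed.

Lemma form_m_psd (R : realType) d (Omega : set 'rV[R]_d) (Th : mesh Omega)
    k n (phi : 'I_n -> broken Th R) :
  is_basis (Qh (Th := Th) k) phi -> psd (form_mx (form_m (Th := Th)) phi phi).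
Proof.
move=> [phiQ _]; have [lam cell] := choice (simplex_cell (Th := Th)).
apply: (proj1 (gram_polynomial (f := fun i T (_ : 'I_1) => phi i T) cell _ _)).
  by move=> i T _; exact: polyfun_polynomial_map (proj1 (phiQ i) T).
move=> i j; rewrite mxE; apply: eq_bigr => T _; congr vol_int.
by apply/funext => x; rewrite big_ord1.
Qed.

End Preliminaries.

Theorem theorem4p2 (R : realType) (d : nat) (Omega : set 'rV[R]_d) (k : nat)
    (eta sigma rhoS rhoU cQ CQ : R) :
  d = 2%N \/ d = 3%N ->
  polyhedral_domain Omega ->
  (1 <= k)%N ->
  0 < eta ->
  0 < sigma ->
  0 <= rhoS < 1 ->
  0 <= rhoU < 1 ->
  0 < cQ -> 0 < CQ ->
  1 + rhoS + (1 + rhoU) * (1 + 2 * rhoS + 2 * rhoS ^+ 2) < 4 ->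
  exists c C : R, [/\ 0 < c, 0 < C &
    forall (nu : R) (Th : mesh Omega) (nS nU nQ : nat)
      (phiS : 'I_nS -> broken Th 'M[R]_d)
      (phiU : 'I_nU -> broken Th 'rV[R]_d * broken Th 'M[R]_d)
      (phiQ : 'I_nQ -> broken Th R)
      (HS : 'M[R]_nS) (HU : 'M[R]_nU) (HQ : 'M[R]_nQ),
    0 < nu ->
    quasi_uniform Th sigma ->
    is_basis (Sigmah_plus (Th := Th) k) phiS ->
    is_basis (Uh (Th := Th) k) phiU ->
    is_basis (Qh (Th := Th) k) phiQ ->
    let A := form_mx (form_a (Th := Th) nu) phiS phiS in
    let B1 := form_mx (form_b1 (Th := Th)) phiU phiQ in
    let B2 := form_mx (form_b2 (Th := Th)) phiS phiU in
    let M := form_mx (form_m (Th := Th)) phiQ phiQ in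
    let SU := SchurU eta nu A B1 B2 M in
    let SQ := SchurQ SU B1 in
    spd HS -> spd HU -> spd HQ ->
    SU \in unitmx ->
    (opnorm A (1%:M - invmx HS *m A) <= rhoS%:E)%E ->
    (opnorm SU (1%:M - invmx HU *m SU) <= rhoU%:E)%E ->
    spectral_equiv cQ CQ HQ SQ ->
    let P := LhatT HS HU HQ B1 B2 *m Abar eta nu A B1 B2 M in
    let H := Hdiag HS HU HQ in
    (c%:E <= fov_inf H P)%E /\ (fov_sup H P <= C%:E)%E].
Proof.
move=> d23 _ _ eta0 _ aS aU cQ0 CQ0 _.
have [c [C [c0 C0 fov]]] := block_triangular_fov aS aU cQ0 CQ0.
exists c, C; split=> // nu Th nS nU nQ phiS phiU phiQ HS HU HQ nu0 _ bS _ bQ.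
move=> A B1 B2 M SU SQ sHS sHU sHQ uSU HSA HUS HQS P H.
(* Unification finds [D = (eta * nu) *: (B1^T *m invmx M *m B1)], whose semidefiniteness remains to
   be shown. *)
apply: (fov nS nU nQ A HS _ HU HQ B1 B2) => //; first exact: form_a_spd bS.
apply: psd_congr; first by rewrite mulr_ge0 ?ltW.
exact/psd_invmx/(form_m_psd bQ).
Qed.
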